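(* Let $c>2\log 3$, let $\rho\in\left(\sqrt{\frac{2\log 3}{c}},\,1\right)$, and let $\gamma=\frac{c\rho^2}{2}-\log 3>0$. For $d\ge 1$, let $G_d=(\mathbb{Z}/3\mathbb{Z})^d$ and $m_d=\lceil cd\rceil$, and let $d_0\ge 1$ satisfy $m_d\le 3^d-1$ for every $d\ge d_0$. Let $(S_d)_{d\ge d_0}$ be random subsets defined on a common probability space such that, for every $d\ge d_0$, $S_d$ is uniformly distributed over the $m_d$-element subsets of $G_d\setminus\{0\}$. Then the following hold. (1) For every $d\ge d_0$, with probability at least $1-e^{-\gamma d}-m_d\,3^{1-d}$, the set $S_d$ generates $G_d$, $S_d\ne -S_d$, and the finite irreducible Markov chain $(G_d,P_{S_d})$ satisfies $$k_{(G_d,P_{S_d})}=2,\qquad \Delta(P_{S_d})=m_d,\qquad t_{\mathrm{rel}}\le\frac{1}{1-\rho},\qquad \mathrm{BE}(G_d,P_{S_d})\ge 0.$$ (2) Almost surely, there exists $d_1\ge d_0$ such that, for every $d\ge d_1$, $S_d$ generates $G_d$, $S_d\neq -S_d$ and $(G_d,P_{S_d})$ is a finite irreducible Markov chain with the four properties displayed in (1); the sequence $(G_d,P_{S_d})_{d\ge d_1}$ satisfies, for every $\varepsilon\in(0,1/2)$, $$\lim_{d\to\infty}\frac{k_{(G_d,P_{S_d})}^2\,(1+\log\Delta(P_{S_d}))\,t_{\mathrm{rel}}^{(d)}}{\sqrt{t_{\mathrm{mix}}^{(d)}(1-\varepsilon)}}=0;$$ and a cutoff occurs for it, that is, $\lim_{d\to\infty}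 t_{\mathrm{mix}}^{(d)}(\varepsilon)/t_{\mathrm{mix}}^{(d)}(1-\varepsilon)=1$ for every $\varepsilon\in(0,1)$.
   Context: Groups are written additively; $-S=\{-s : s\in S\}$. For a non-empty subset $S$ of a finite Abelian group $G$, $P_S$ is the stochastic matrix on $G$ with $P_S(x,x+s)=1/|S|$ for $x\in G$, $s\in S$, and $P_S(x,y)=0$ if $y-x\notin S$. For a finite irreducible Markov chain $(\mathcal{X},P)$ with $|\mathcal{X}|\ge 2$ and stationary distribution $\pi$: $\mathscr{P}_t(x,y)=e^{-t}\sum_{m\ge0}\frac{t^m}{m!}P^m(x,y)$; $\|\mu_1-\mu_2\|_{\mathrm{TV}}=\frac12\sum_x|\mu_1(x)-\mu_2(x)|$; $t_{\mathrm{mix}}(\varepsilon)=\inf\{t\ge0:\max_x\|\mathscr{P}_t(x,\cdot)-\pi\|_{\mathrm{TV}}\le\varepsilon\}$ for $0<\varepsilon<1$; $\Gamma(f,g)(x)=\frac12\sum_y(f(x)-f(y))(g(x)-g(y))P(x,y)$, $\Gamma(f)=\Gamma(f,f)$, $\mathcal{E}(f)=\sum_x\Gamma(f)(x)\pi(x)$, and $t_{\mathrm{rel}}=\sup\{\mathrm{Var}_\pi(f)/\mathcal{E}(f): f:\mathcal{X}\to\mathbb{R},\ \mathcal{E}(f)>0\}$, where $\mathrm{Var}_\pi$ is the variance under $\pi$. $\Delta(P)=\max\{1/P(x,y):P(x,y)>0,\ x\ne y\}$; $d_P(x\to y)=\min\{k\in\mathbb{N}_0:P^k(x,y)>0\}$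 (with $P^0=I$); $k_{(\mathcal{X},P)}=\max\{d_P(y\to x):d_P(x\to y)=1\}$. $\mathcal{L}f(x)=\sum_yP(x,y)(f(y)-f(x))$; the Bakry--Émery curvature $\mathrm{BE}(\mathcal{X},P)$ is the supremum of all $\kappa$ such that $\frac12\mathcal{L}\Gamma(f)(x)\ge\Gamma(f,\mathcal{L}f)(x)+\kappa\Gamma(f)(x)$ for all $f:\mathcal{X}\to\mathbb{R}$, $x\in\mathcal{X}$. $t_{\mathrm{rel}}$ in (1) is the relaxation time of $(G_d,P_{S_d})$; $t_{\mathrm{rel}}^{(d)}$ and $t_{\mathrm{mix}}^{(d)}(\cdot)$ are the relaxation and mixing times of $(G_d,P_{S_d})$. A quotient with positive numerator and zero denominator is read as $+\infty$. *)

(* Defs.v *)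
From HB Require Import structures.
From mathcomp Require Import all_boot all_order all_algebra all_fingroup.
From mathcomp Require Import all_classical all_reals all_analysis.

Set Implicit Arguments.
Unset Strict Implicit.
Unset Printing Implicit Defensive.

Import Order.TTheory GRing.Theory Num.Theory.
Import numFieldNormedType.Exports.

Local Open Scope ring_scope.

(* A transition kernel on a finite state space [X] is a function
   [P : X -> X -> R]; suprema and infima of sets of reals are taken in
   [\bar R], so that no junk value arises on empty or unbounded sets.      *)

Definition stochastic (R : realType) (X : finType) (P : X -> X -> R) : Prop :=
  (forall x y, 0 <= P x y) /\ (forall x, \sum_(y : X) P x y = 1).

Fixpoint kpow (R : realType) (X : finType) (P : X -> X -> R) (m : nat)
    (x y : X) : R :=
  if m is m'.+1 then \sum_(z : X) P x z * kpow P m' z y else (x == y)%:R.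

Definition irreducible_chain (R : realType) (X : finType) (P : X -> X -> R) :
    Prop :=
  [/\ (1 < #|X|)%N, stochastic P & forall x y, exists m, 0 < kpow P m x y].

Definition is_stationary (R : realType) (X : finType) (P : X -> X -> R)
    (pi : X -> R) : Prop :=
  [/\ forall x, 0 <= pi x, \sum_(x : X) pi x = 1
    & forall y, \sum_(x : X) pi x * P x y = pi y].

(* For an irreducible chain exactly one such distribution exists; the default
   value of [xget] is only reached when there is none.                     *)
Definition stationary_dist (R : realType) (X : finType) (P : X -> X -> R) : X -> R :=
  xget (fun=> 0) [set pi | is_stationary P pi]%classic.

Definition heat_kernel (R : realType) (X : finType) (P : X -> X -> R) (t : R)
    (x y : X) : R :=
  expR (- t) * limn (series (fun m : nat => t ^+ m / m`!%:R * kpow P m x y)).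

Definition tv_dist (R : realType) (X : finType) (mu nu : X -> R) : R :=
  2^-1 * \sum_(x : X) `|mu x - nu x|.

Definition tmix (R : realType) (X : finType) (P : X -> X -> R) (eps : R) :
    \bar R :=
  ereal_inf [set t%:E | t in [set t : R | 0 <= t /\
    \big[Num.max/0]_(x : X) tv_dist (heat_kernel P t x) (stationary_dist P)
      <= eps]]%classic.

Definition Gamma (R : realType) (X : finType) (P : X -> X -> R) (f g : X -> R)
    (x : X) : R :=
  2^-1 * \sum_(y : X) (f x - f y) * (g x - g y) * P x y.

Definition dirichlet (R : realType) (X : finType) (P : X -> X -> R)
    (f : X -> R) : R :=
  \sum_(x : X) Gamma P f f x * stationary_dist P x.

Definition fin_mean (R : realType) (X : finType) (mu f : X -> R) : R :=
  \sum_(x : X) f x * mu x.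

Definition fin_variance (R : realType) (X : finType) (mu f : X -> R) : R :=
  fin_mean mu (fun x => (f x - fin_mean mu f) ^+ 2).

Definition trel (R : realType) (X : finType) (P : X -> X -> R) : \bar R :=
  ereal_sup [set (fin_variance (stationary_dist P) f / dirichlet P f)%:E
            | f in [set f : X -> R | 0 < dirichlet P f]]%classic.

Definition Delta (R : realType) (X : finType) (P : X -> X -> R) : R :=
  \big[Num.max/0]_(xy : X * X | (0 < P xy.1 xy.2) && (xy.1 != xy.2))
    (P xy.1 xy.2)^-1.

(* The value 0 of the second branch is never taken for irreducible chains. *)
Definition hit_dist (R : realType) (X : finType) (P : X -> X -> R) (x y : X) : nat :=
  match pselect (exists k, 0 < kpow P k x y) with
  | left h => ex_minn h
  | right _ => 0%N
  end.

Definition kmax (R : realType) (X : finType) (P : X -> X -> R) : nat :=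
  \max_(xy : X * X | hit_dist P xy.1 xy.2 == 1%N) hit_dist P xy.2 xy.1.

Definition markov_generator (R : realType) (X : finType) (P : X -> X -> R)
    (f : X -> R) (x : X) : R :=
  \sum_(y : X) P x y * (f y - f x).

Definition bakry_emery (R : realType) (X : finType) (P : X -> X -> R) : \bar R :=
  ereal_sup [set kappa%:E | kappa in [set kappa : R |
    forall (f : X -> R) (x : X),
      Gamma P f (markov_generator P f) x + kappa * Gamma P f f x
        <= 2^-1 * markov_generator P (Gamma P f f) x]]%classic.

(* In [\bar R] one has [0^-1 = +oo], hence [a / 0 = +oo] for [a > 0].      *)
Definition cutoff (R : realType) (X : nat -> finType)
    (P : forall n, X n -> X n -> R) : Prop :=
  forall eps : R, 0 < eps < 1 ->
    ((fun n => tmix (P n) eps / tmix (P n) (1 - eps))%E @ \oo --> 1%E)%classic.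

Definition cayley_kernel (R : realType) (G : finZmodType) (S : {set G})
    (x y : G) : R :=
  if y - x \in S then #|S|%:R^-1 else 0.

Definition opp_set (G : finZmodType) (S : {set G}) : {set G} :=
  [set - s | s in S]%SET.

(* The group law of [G] as a [finGroupType] is its addition.               *)
Definition generates (G : finZmodType) (S : {set G}) : Prop :=
  <<S>>%g = [set: G]%SET.

Definition uniform_on (R : realType) (disp : measure_display)
    (Omega : measurableType disp) (Pr : probability Omega R) (E : finType)
    (X : Omega -> E) (A : {set E}) : Prop :=
  forall a : E, measurable (X @^-1` [set a])%classic /\
    Pr (X @^-1` [set a])%classic = ((a \in A)%:R / #|A|%:R)%:E.

Definition nonzero_subsets (G : finZmodType) (m : nat) : {set {set G}} :=
  [set A : {set G} | (0 \notin A) && (#|A| == m)]%SET.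

Definition Z3pow (d : nat) : finZmodType := 'rV['Z_3]_d.

(* [c] is positive wherever this is used, so [absz] does not change the sign. *)
Definition gens_card (R : realType) (c : R) (d : nat) : nat :=
  `|Num.ceil (c * d%:R)|%N.

Definition nonreversible_walk_bounds (R : realType) (G : finZmodType)
    (S : {set G}) (m : nat) (rho : R) : Prop :=
  let P := @cayley_kernel R G S in
  [/\ generates S, S <> opp_set S, irreducible_chain P &
    [/\ kmax P = 2%N, Delta P = m%:R,
        (trel P <= (1 / (1 - rho))%:E)%E & (0 <= bakry_emery P)%E]].

(* Main.v *)
(* The Poincare inequality with constant [1 - rho] follows from the bound
   [Re chi(S) <= rho |S|] for every nontrivial character [chi] of (Z/3)^d.  This
   bound holds for random [S] by a Chernoff estimate and a union bound over the
   characters; sampling without replacement only improves the exponential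
   moment.  Borel-Cantelli then makes every large [d] good, and cutoff is a
   deterministic consequence.

   For cutoff, let [h] be the law of the walk at a time [t] where its total
   variation distance is at most [1 - eps].  Each generator contributes an
   independent Poisson number of jumps modulo 3, so for [t >= 1] the
   log-density [g = ln (N h)] changes by O(log m) along each generator, and the
   local Poincare inequality (which holds since translations commute with the
   semigroup) bounds the variance of [g] under [h] by O(t log^2 m).  Hence the
   mean of [g] is O(sqrt t log m), and after truncating [h] at this density
   level the spectral gap completes the mixing within a further time
   O(sqrt t log m).  As only [(m + 1) ^ k] vertices lie within [k] jumps, [t] is
   at least of order [d / log m], so this window is o(t). *)
Require Import Defs.
From HB Require Import structures.
From mathcomp Require Import all_boot all_order all_algebra all_fingroup.
From mathcomp Require Import all_classical all_reals all_analysis.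
From mathcomp Require Import ring lra zify.

Set Implicit Arguments.
Unset Strict Implicit.
Unset Printing Implicit Defensive.

Import Order.TTheory GRing.Theory Num.Theory.
Import numFieldNormedType.Exports.

Local Open Scope ring_scope.

(** * The heat semigroup of a finite chain *)

(** The walk is not reversible and its eigenvalues may be complex. Every L^2 estimate therefore uses
    the energy identity [sum_Gamma], which follows from invariance of the counting measure and sees
    only the real parts of the eigenvalues; hence the Fourier analysis stays over the reals, with
    [cos3] and [sin3]. The Poincare inequality gives more than relaxation: a mean-zero function of
    zero energy vanishes, so S generates the group, the chain is irreducible and the uniform law is
    its only stationary law. The one other random event to exclude is S = -S, whose probability is
    at most (m - 1) / (3^d - 2) by counting pairs; since 3 s = 0, its failure gives k = 2.
    Nonnegative curvature comes from commutativity alone. The constant gamma is a balance: the 3^d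
    characters cost exp(d ln 3), each one fails with probability at most exp(- m rho^2 / 2), and m
    >= c d. *)

Lemma is_derive_sum_fin (R : realType) (I : finType) (F : I -> R -> R)
    (dF : I -> R) (t : R) :
  (forall i, is_derive t 1 (F i) (dF i)) ->
  is_derive t 1 (fun u => \sum_(i : I) F i u) (\sum_(i : I) dF i).
Proof.
move=> dFi; rewrite (_ : (fun u => _) = \sum_(i : I) F i); last first.
  by apply/funext => u; rewrite fct_sumE.
by elim/big_ind2 : _ => // [|] *; [exact: is_derive_cst|exact: is_deriveD].
Qed.

Lemma is_derive_mul (R : realType) (f g : R -> R) (df dg t : R) :
  is_derive t 1 f df -> is_derive t 1 g dg ->
  is_derive t 1 (fun u => f u * g u) (df * g t + f t * dg).
Proof.
move=> hf hg; have := is_deriveM hf hg.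
by move=> h; apply: is_derive_eq h _; rewrite /GRing.scale/=; ring.
Qed.

Lemma is_derive_affine (R : realType) (f : R -> R) (df a b t : R) :
  is_derive (a + b * t) 1 f df ->
  is_derive t 1 (fun u => f (a + b * u)) (b * df).
Proof.
move=> hf.
have hg : is_derive t 1 (fun u : R => a + b * u) b.
  have h := is_deriveD (is_derive_cst a t 1) (is_deriveZ b (is_derive_id t 1)).
  by apply: is_derive_eq h _; rewrite /GRing.scale/= add0r mulr1.
have h := @is_derive1_comp R f (fun u => a + b * u) t _ _ hf hg.
by apply: is_derive_eq h _; rewrite mulrC.
Qed.

Lemma is_derive_le (R : realType) (f df : R -> R) (K a b : R) :
  a <= b -> (forall t : R, is_derive t 1 f (df t)) ->
  (forall t, a <= t <= b -> df t <= K) -> f b - f a <= K * (b - a).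
Proof.
move=> ab hf hK.
have [c cab ->] := MVT_segment ab (fun x _ => hf x) (derivable_within_continuous
  (fun x _ => @ex_derive _ _ _ _ _ _ _ (hf x))).
by rewrite ler_wpM2r ?subr_ge0// hK.
Qed.

Lemma is_derive_eq0 (R : realType) (f : R -> R) (a b : R) :
  (forall t : R, is_derive t 1 f 0) -> f a = f b.
Proof.
wlog ab : a b / a <= b => [hw hf|hf].
  by have [|/ltW] := lerP a b => ab; [exact: hw|apply/esym; exact: hw].
have h1 := is_derive_le ab hf (fun t _ => lexx 0).
have hN : forall t : R, is_derive t 1 (- f) (0 : R).
  by move=> t; have := is_deriveN (hf t); rewrite oppr0.
have h2 := is_derive_le ab hN (fun t _ => lexx 0).
have {}h2 : - f b - - f a <= 0 by rewrite mul0r in h2.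
by move: h1; rewrite mul0r; lra.
Qed.

Section exponential_generating_function.
Variable R : realType.
Implicit Types b : nat -> R.

(** Written as a power series so that termwise differentiation applies: it shifts the coefficients,
    which turns the two recursions for [kpow] into the backward and forward equations of
    [heat_kernel]. *)
Definition egf b (t : R) : R := limn (pseries (fun m => b m / m`!%:R) t).

Lemma pseries_diffs_egf b :
  pseries_diffs (fun m => b m / m`!%:R) = (fun m => b m.+1 / m`!%:R).
Proof.
apply/funext => i; rewrite /pseries_diffs factS natrM invfM mulrCA.
by rewrite mulVKf// pnatr_eq0.
Qed.

Lemma is_cvg_egf b t : (forall m, `|b m| <= 1) ->
  cvgn (pseries (fun m => b m / m`!%:R) t).
Proof.
move=> b1; apply: normed_cvg; apply: series_le_cvg (is_cvg_series_exp_coeff `|t|).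
- by move=> n; exact: normr_ge0.
- by move=> n; exact: exp_coeff_ge0.
- move=> n /=; rewrite /exp_coeff/= !normrM normfV normrX.
  rewrite (ger0_norm (ler0n _ _)) mulrC ler_wpM2l ?exprn_ge0//.
  by rewrite -[leRHS]mul1r ler_wpM2r.
Qed.

Lemma is_derive_egf b (t : R) : (forall m, `|b m| <= 1) ->
  is_derive t 1 (egf b) (egf (fun m => b m.+1) t).
Proof.
move=> b1; rewrite /egf.
have := @pseries_snd_diffs R (fun m => b m / m`!%:R) (`|t| + 1) t.
rewrite !pseries_diffs_egf; apply; try exact: is_cvg_egf.
by rewrite (ger0_norm (addr_ge0 _ _))// ltrDl.
Qed.

Lemma egf_sum (I : finType) (a : I -> R) (b : I -> nat -> R) t :
  (forall i m, `|b i m| <= 1) ->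
  egf (fun m => \sum_i a i * b i m) t = \sum_i a i * egf (b i) t.
Proof.
move=> b1; apply/cvg_lim => //.
rewrite (_ : pseries _ _ =
    (fun n => \sum_i a i * pseries (fun m => b i m / m`!%:R) t n)); last first.
  apply/funext => n; rewrite /pseries /series/=.
  under [RHS]eq_bigr do rewrite mulr_sumr.
  rewrite exchange_big/=; apply: eq_bigr => m _.
  by rewrite mulr_suml mulr_suml; apply: eq_bigr => i _; ring.
apply: cvg_big => [|i _]; first exact: add_continuous.
apply: cvgMl_tmp.
exact: is_cvg_egf.
Qed.

Lemma egf_ge b t m : (forall m, 0 <= b m <= 1) -> 0 <= t ->
  b m / m`!%:R * t ^+ m <= egf b t.
Proof.
move=> b1 t0.
have c : cvgn (pseries (fun m => b m / m`!%:R) t).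
  by apply: is_cvg_egf => k; have /andP[? ?] := b1 k; rewrite ger0_norm.
have nd : nondecreasing_seq (pseries (fun m => b m / m`!%:R) t).
  apply/nondecreasing_seqP => n; rewrite /pseries /series/= big_nat_recr//=.
  by rewrite lerDl !mulr_ge0 ?exprn_ge0 ?invr_ge0//; have /andP[] := b1 n.
apply: le_trans (nondecreasing_cvgn_le nd c m.+1).
rewrite /pseries /series/= big_nat_recr//= lerDr sumr_ge0// => i _.
by rewrite !mulr_ge0 ?exprn_ge0 ?invr_ge0//; have /andP[] := b1 i.
Qed.

Lemma egf0 b : egf b 0 = b 0%N.
Proof.
apply/cvg_lim => //; rewrite -(cvg_shiftS (pseries _ _)).
rewrite (_ : (fun n => _) = cst (b 0%N)); first exact: cvg_cst.
apply/funext => n; rewrite /pseries /series/= big_nat_recl//= big1 ?addr0.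
  by rewrite fact0 expr0 divr1 mulr1.
by move=> i _; rewrite expr0n mulr0.
Qed.

End exponential_generating_function.

Section heat_semigroup.
Variables (R : realType) (X : finType) (P : X -> X -> R).
Hypothesis P_stoch : stochastic P.

Let P0 x y : 0 <= P x y. Proof. exact: (P_stoch.1). Qed.
Let P1 x : \sum_y P x y = 1. Proof. exact: (P_stoch.2). Qed.

Lemma kpow_ge0 m x y : 0 <= kpow P m x y.
Proof.
by elim: m x y => [|m IH] x y /=; [rewrite ler0n|rewrite sumr_ge0// => z _; rewrite mulr_ge0].
Qed.

Lemma kpow_sum m x : \sum_y kpow P m x y = 1.
Proof.
elim: m x => [|m IH] x /=.
  by rewrite (bigD1 x)//= eqxx big1 ?addr0// => y /negbTE; rewrite eq_sym => ->.
rewrite exchange_big/= -[RHS](P1 x); apply: eq_bigr => z _.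
by rewrite -mulr_sumr IH mulr1.
Qed.

Lemma kpow_le1 m x y : kpow P m x y <= 1.
Proof.
rewrite -(kpow_sum m x) (bigD1 y)//= lerDl sumr_ge0// => z _; exact: kpow_ge0.
Qed.

Let kpow_norm m x y : `|kpow P m x y| <= 1.
Proof. by rewrite ger0_norm ?kpow_ge0 ?kpow_le1. Qed.

(** [kpow] unfolds at its first step; the forward equation [is_derive_heatr] rests on unfolding at
    the last one. *)
Lemma kpow_recr m x y : kpow P m.+1 x y = \sum_z P z y * kpow P m x z.
Proof.
elim: m x => [|m IH] x.
  rewrite /= (bigD1 y)//= eqxx mulr1 big1 ?addr0; last first.
    by move=> z /negbTE ->; rewrite mulr0.
  rewrite (bigD1 x)//= eqxx mulr1 big1 ?addr0// => z.
  by rewrite eq_sym => /negbTE ->; rewrite mulr0.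
transitivity (\sum_w P x w * kpow P m.+1 w y); first by [].
under eq_bigr do rewrite IH mulr_sumr.
rewrite exchange_big/=; apply: eq_bigr => z _.
by rewrite mulr_sumr; apply: eq_bigr => w _; ring.
Qed.

Lemma heat_kernelE t x y :
  heat_kernel P t x y = expR (- t) * egf (fun m => kpow P m x y) t.
Proof.
rewrite /heat_kernel /egf /pseries.
suff -> : (fun m => kpow P m x y / m`!%:R * t ^+ m) =
          (fun m => t ^+ m / m`!%:R * kpow P m x y) by [].
by apply/funext => m; ring.
Qed.

Lemma heat_kernel_ge t x y m : 0 <= t ->
  expR (- t) * (kpow P m x y / m`!%:R * t ^+ m) <= heat_kernel P t x y.
Proof.
move=> t0; rewrite heat_kernelE ler_wpM2l ?expR_ge0//.
by apply: (@egf_ge _ (fun m => kpow P m x y)) => // k; rewrite kpow_ge0 kpow_le1.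
Qed.

Lemma heat_kernel_ge0 t x y : 0 <= t -> 0 <= heat_kernel P t x y.
Proof.
move=> t0; apply: le_trans (heat_kernel_ge x y 0 t0).
by rewrite !mulr_ge0 ?expR_ge0 ?kpow_ge0 ?invr_ge0.
Qed.

Lemma heat_kernel0 x y : heat_kernel P 0 x y = (x == y)%:R.
Proof. by rewrite heat_kernelE oppr0 expR0 mul1r egf0. Qed.

Let is_derive_heat (t : R) x y : is_derive t 1 (fun u => heat_kernel P u x y)
  (expR (- t) * egf (fun m => kpow P m.+1 x y) t - heat_kernel P t x y).
Proof.
rewrite (_ : (fun u => _) =
  (fun u => expR (- u) * egf (fun m => kpow P m x y) u)); last first.
  by apply/funext => u; rewrite heat_kernelE.
have he : is_derive t 1 (fun u => expR (- u)) (- expR (- t)).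
  have h := @is_derive_affine R expR (expR (0 + -1 * t)) 0 (-1) t (is_derive_expR _).
  rewrite (_ : (fun u => _) = (fun u => expR (0 + -1 * u))); last first.
    by apply/funext => u; rewrite add0r mulN1r.
  by apply: is_derive_eq h _; rewrite add0r !mulN1r.
have h := is_derive_mul he (@is_derive_egf R (fun m => kpow P m x y) t
  (fun m => kpow_norm m x y)).
by apply: is_derive_eq h _; rewrite heat_kernelE; ring.
Qed.

Lemma is_derive_heatl (t : R) x y : is_derive t 1 (fun u => heat_kernel P u x y)
  (\sum_z P x z * heat_kernel P t z y - heat_kernel P t x y).
Proof.
apply: is_derive_eq (is_derive_heat t x y) _.
rewrite (@egf_sum _ _ (P x) (fun z m => kpow P m z y))//.
by rewrite mulr_sumr; congr (_ - _); apply: eq_bigr => z _; rewrite heat_kernelE; ring.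
Qed.

Lemma is_derive_heatr (t : R) x y : is_derive t 1 (fun u => heat_kernel P u x y)
  (\sum_z P z y * heat_kernel P t x z - heat_kernel P t x y).
Proof.
apply: is_derive_eq (is_derive_heat t x y) _.
under [in LHS]eq_fun do rewrite kpow_recr.
rewrite (@egf_sum _ _ (P^~ y) (fun z m => kpow P m x z))//.
by rewrite mulr_sumr; congr (_ - _); apply: eq_bigr => z _; rewrite heat_kernelE; ring.
Qed.

Definition heat_op (t : R) (f : X -> R) (x : X) : R :=
  \sum_y heat_kernel P t x y * f y.

Lemma markov_generatorE (f : X -> R) x :
  markov_generator P f x = \sum_y P x y * f y - f x.
Proof.
rewrite /markov_generator; under eq_bigr do rewrite mulrBr.
by rewrite big_split/= sumrN -mulr_suml P1 mul1r.
Qed.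

Lemma heat_op_generator t (f : X -> R) x :
  heat_op t (markov_generator P f) x =
  \sum_y (\sum_z P z y * heat_kernel P t x z - heat_kernel P t x y) * f y.
Proof.
rewrite /heat_op; under eq_bigr do rewrite markov_generatorE mulrBr mulr_sumr.
under [RHS]eq_bigr do rewrite mulrBl mulr_suml.
rewrite !sumrB; congr (_ - _).
by rewrite exchange_big/=; apply: eq_bigr => y _; apply: eq_bigr => z _; ring.
Qed.

Lemma is_derive_heat_op (t : R) (f : X -> R) x :
  is_derive t 1 (fun u => heat_op u f x)
    (markov_generator P (fun z => heat_op t f z) x).
Proof.
have h := @is_derive_sum_fin _ _ (fun y u => heat_kernel P u x y * f y) _ t
  (fun y => is_derive_mul (is_derive_heatl t x y) (is_derive_cst (f y) t 1)).
apply: is_derive_eq h _; rewrite markov_generatorE /heat_op.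
under eq_bigr do rewrite mulr0 addr0 mulrBl mulr_suml.
rewrite sumrB exchange_big/=; congr (_ - _); apply: eq_bigr => z _.
by rewrite mulr_sumr; apply: eq_bigr => w _; ring.
Qed.

Lemma heat_op0 (f : X -> R) x : heat_op 0 f x = f x.
Proof.
rewrite /heat_op (bigD1 x)//= heat_kernel0 eqxx mul1r big1 ?addr0// => y.
by rewrite eq_sym heat_kernel0 => /negbTE ->; rewrite mul0r.
Qed.

Lemma heat_op_le t (f g : X -> R) x : 0 <= t -> (forall y, f y <= g y) ->
  heat_op t f x <= heat_op t g x.
Proof.
by move=> t0 fg; apply: ler_sum => y _; rewrite ler_wpM2l ?heat_kernel_ge0.
Qed.

Lemma heat_kernel_sum t x : \sum_y heat_kernel P t x y = 1.
Proof.
have h (u : R) : is_derive u 1 (fun v => \sum_y heat_kernel P v x y) 0.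
  have h := @is_derive_sum_fin _ _ (fun y v => heat_kernel P v x y) _ u
    (fun y => is_derive_heatr u x y).
  apply: is_derive_eq h _; rewrite sumrB exchange_big/=.
  apply/eqP; rewrite subr_eq0; apply/eqP; apply: eq_bigr => z _.
  by rewrite -mulr_suml P1 mul1r.
rewrite (is_derive_eq0 t 0 h) -[RHS](kpow_sum 0 x).
by apply: eq_bigr => y _; rewrite heat_kernel0.
Qed.

(* Duhamel's principle: differentiate [s |-> heat_op (t - s) (z s) x]. *)
Lemma heat_op_duhamel (z dz : R -> X -> R) (K t : R) x : 0 <= t ->
  (forall (s : R) y, is_derive s 1 (z^~ y) (dz s y)) ->
  (forall s y, 0 <= s <= t -> dz s y <= markov_generator P (z s) y + K) ->
  z t x <= heat_op t (z 0) x + K * t.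
Proof.
move=> t0 hz hdz.
pose F s := \sum_y heat_kernel P (t + -1 * s) x y * z s y.
have hF (s : R) : is_derive s 1 F
    (heat_op (t - s) (fun y => dz s y - markov_generator P (z s) y) x).
  have h := @is_derive_sum_fin _ _
    (fun y u => heat_kernel P (t + -1 * u) x y * z u y) _ s
    (fun y => is_derive_mul (is_derive_affine (is_derive_heatr (t + -1 * s) x y)) (hz s y)).
  apply: is_derive_eq h _.
  rewrite mulN1r big_split/=.
  transitivity (heat_op (t - s) (dz s) x - heat_op (t - s) (markov_generator P (z s)) x).
    rewrite heat_op_generator addrC; congr (_ + _).
    by rewrite -sumrN; apply: eq_bigr => y _; rewrite mulN1r mulNr.
  by rewrite -sumrB; apply: eq_bigr => y _; rewrite mulrBr.
have := @is_derive_le _ F _ K 0 t t0 hF.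
rewrite subr0 /F mulN1r subrr mulr0 addr0.
have -> : \sum_y heat_kernel P 0 x y * z t y = z t x by exact: heat_op0.
rewrite lerBlDl => -> // s s0t.
have ts : 0 <= t - s by move/andP: s0t => [? ?]; rewrite subr_ge0.
apply: (le_trans (heat_op_le (g := fun=> K) x ts _)).
  by move=> y; rewrite lerBlDl hdz.
by rewrite /heat_op -mulr_suml heat_kernel_sum mul1r.
Qed.

(** Duhamel with K = 0, applied to z and to -z. Uniqueness yields the semigroup law and, later, the
    factorisation of the kernel along one generator. *)
Lemma heat_op_unique (z : R -> X -> R) t x : 0 <= t ->
  (forall (s : R) y, is_derive s 1 (z^~ y) (markov_generator P (z s) y)) ->
  z t x = heat_op t (z 0) x.
Proof.
move=> t0 hz; apply/eqP; rewrite eq_le; apply/andP; split.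
  have := @heat_op_duhamel z _ 0 t x t0 hz.
  by rewrite mul0r addr0; apply => s y _; rewrite addr0.
have hN (s : R) y : is_derive s 1 (fun u => - z u y) (- markov_generator P (z s) y).
  exact: is_deriveN.
have := @heat_op_duhamel (fun s y => - z s y) _ 0 t x t0 hN.
rewrite mul0r addr0 lerNl => h.
apply: le_trans (h _); last first.
  move=> s y _; rewrite addr0 /markov_generator -sumrN; apply: ler_sum => w _.
  by rewrite le_eqVlt; apply/orP; left; apply/eqP; ring.
by rewrite -sumrN; apply: ler_sum => w _; rewrite mulrN opprK.
Qed.

Lemma heat_opD s t (f : X -> R) x : 0 <= t ->
  heat_op (t + s) f x = heat_op t (heat_op s f) x.
Proof.
move=> t0; rewrite -[in RHS](add0r s).
apply: (@heat_op_unique (fun u => heat_op (u + s) f) t x t0) => u y.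
have h := @is_derive_affine R (fun v => heat_op v f y) _ s 1 u
  (is_derive_heat_op (s + 1 * u) f y).
rewrite (_ : (fun v => _) = (fun v => heat_op (s + 1 * v) f y)); last first.
  by apply/funext => v; rewrite mul1r addrC.
by apply: is_derive_eq h _; rewrite !mul1r addrC.
Qed.

End heat_semigroup.

(** * Walks on finite abelian groups *)
Lemma sum_addr (R : zmodType) (G : finZmodType) (F : G -> R) (a : G) :
  \sum_x F (x + a) = \sum_x F x.
Proof.
by rewrite [RHS](reindex_inj (addIr a)).
Qed.

Lemma sum_const_fin (R : realType) (X : finType) (a : R) :
  \sum_(x : X) a = #|X|%:R * a.
Proof. by rewrite sumr_const mulr_natl. Qed.

Lemma sum_const_set (R : realType) (X : finType) (A : {set X}) (a : R) :
  \sum_(x in A) a = #|A|%:R * a.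
Proof. by rewrite sumr_const mulr_natl. Qed.

(** Cauchy-Schwarz against the constant 1, from expanding the sum of (|w x| - |w y|)^2 over all
    pairs. *)
Lemma sum_sqr_le (R : realType) (X : finType) (w : X -> R) :
  (\sum_x `|w x|) ^+ 2 <= #|X|%:R * \sum_x w x ^+ 2.
Proof.
have : 0 <= \sum_x \sum_y (`|w x| - `|w y|) ^+ 2.
  by apply: sumr_ge0 => x _; apply: sumr_ge0 => y _; exact: sqr_ge0.
have -> : \sum_x \sum_y (`|w x| - `|w y|) ^+ 2 =
    2 * (#|X|%:R * (\sum_x w x ^+ 2)) - 2 * (\sum_x `|w x|) ^+ 2.
  transitivity (\sum_x \sum_y (w x ^+ 2 + w y ^+ 2 - 2 * (`|w x| * `|w y|))).
    apply: eq_bigr => x _; apply: eq_bigr => y _.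
    by rewrite -(real_normK (num_real (w x))) -(real_normK (num_real (w y))); ring.
  under eq_bigr do rewrite sumrB big_split/=.
  rewrite sumrB big_split/=; congr (_ - _).
    under eq_bigr do rewrite sumr_const.
    rewrite sumr_const -mulr_natl -sumrMnl.
    under eq_bigr do rewrite -mulr_natl.
    by rewrite -mulr_sumr -[LHS]/(_ + _); ring.
  rewrite expr2 mulr_suml mulr_sumr; apply: eq_bigr => x _.
  by rewrite 2!mulr_sumr.
lra.
Qed.

Section cayley_walk.
Variables (R : realType) (G : finZmodType) (S : {set G}).
Hypothesis S_neq0 : (0 < #|S|)%N.

Let P := @cayley_kernel R G S.
Let m : R := #|S|%:R.
Let N : R := #|G|%:R.

Let m_gt0 : 0 < m. Proof. by rewrite ltr0n. Qed.
Let N_gt0 : 0 < N. Proof. by rewrite ltr0n; apply/card_gt0P; exists 0. Qed.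

Lemma cayley_sum x (f : G -> R) : \sum_y P x y * f y = m^-1 * \sum_(s in S) f (x + s).
Proof.
rewrite -(sum_addr _ x) mulr_sumr [RHS]big_mkcond; apply: eq_bigr => s _.
by rewrite /P /cayley_kernel addrK addrC; case: ifP => // _; rewrite mul0r.
Qed.

Lemma cayley_sum_sub y (f : G -> R) :
  \sum_x P x y * f x = m^-1 * \sum_(s in S) f (y - s).
Proof.
rewrite (reindex_inj (inj_comp (addrI y) (@oppr_inj G)))/= mulr_sumr [RHS]big_mkcond.
apply: eq_bigr => s _.
by rewrite /P /cayley_kernel opprD addrA subrr add0r opprK; case: ifP => // _; rewrite mul0r.
Qed.

Lemma cayley_stochastic : stochastic P.
Proof.
split=> [x y|x]; first by rewrite /P /cayley_kernel; case: ifP.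
under eq_bigr do rewrite -[P x _]mulr1.
by rewrite (cayley_sum x (fun=> 1)) sumr_const mulVf ?gt_eqF.
Qed.
Local Notation Pst := cayley_stochastic.

Lemma cayley_generatorE (f : G -> R) x :
  markov_generator P f x = m^-1 * \sum_(s in S) (f (x + s) - f x).
Proof. exact: cayley_sum. Qed.

Lemma cayley_GammaE (f g : G -> R) x : Gamma P f g x =
  2^-1 * (m^-1 * \sum_(s in S) (f (x + s) - f x) * (g (x + s) - g x)).
Proof.
rewrite /Gamma -(cayley_sum x (fun y => (f y - f x) * (g y - g x))).
by congr (_ * _); apply: eq_bigr => y _; ring.
Qed.

Lemma kpow_add k x y z : kpow P k (x + z) (y + z) = kpow P k x y.
Proof.
elim: k x => [|k IH] x /=; first by rewrite (inj_eq (addIr z)).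
rewrite -(sum_addr _ z); apply: eq_bigr => w _; rewrite IH; congr (_ * _).
by rewrite /P /cayley_kernel opprD addrACA subrr addr0.
Qed.

Lemma heat_kernel_add t x y z :
  heat_kernel P t (x + z) (y + z) = heat_kernel P t x y.
Proof.
by rewrite !heat_kernelE; congr (_ * egf _ _); apply/funext => k; rewrite kpow_add.
Qed.

Lemma heat_kernel_sub t x y : heat_kernel P t x y = heat_kernel P t (x - y) 0.
Proof. by rewrite -(heat_kernel_add t x y (- y)) subrr. Qed.

(** Translation invariance turns the sum over starting points into a sum over end points, which is
    1: the counting measure is invariant. *)
Lemma sum_heat_op t (f : G -> R) : \sum_x heat_op P t f x = \sum_x f x.
Proof.
rewrite /heat_op exchange_big/=; apply: eq_bigr => y _.
rewrite -mulr_suml -[RHS]mul1r; congr (_ * _).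
rewrite -(heat_kernel_sum Pst t 0).
rewrite (reindex_inj (inj_comp (addrI y) (@oppr_inj G)))/=.
apply: eq_bigr => s _.
by rewrite -[RHS](heat_kernel_add t _ _ (y - s)) add0r [s + _]addrC subrK.
Qed.

Lemma heat_op_add t (f : G -> R) x s :
  heat_op P t f (x + s) = heat_op P t (fun y => f (y + s)) x.
Proof.
by rewrite /heat_op -(sum_addr _ s); apply: eq_bigr => y _; rewrite heat_kernel_add.
Qed.

Lemma heat_op_sub t (f g : G -> R) x :
  heat_op P t (fun y => f y - g y) x = heat_op P t f x - heat_op P t g x.
Proof. by rewrite /heat_op -sumrB; apply: eq_bigr => y _; rewrite mulrBr. Qed.

Lemma heat_op_cst t (a : R) x : heat_op P t (fun=> a) x = a.
Proof. by rewrite /heat_op -mulr_suml (heat_kernel_sum Pst) mul1r. Qed.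

Lemma generator_sqr (f : G -> R) x :
  markov_generator P (fun y => f y ^+ 2) x =
  2 * f x * markov_generator P f x + 2 * Gamma P f f x.
Proof.
rewrite !cayley_generatorE cayley_GammaE mulVKf ?pnatr_eq0//.
by rewrite mulrCA -mulrDr; congr (_ * _); rewrite mulr_sumr -big_split/=; apply: eq_bigr => s _; ring.
Qed.

(* The carre du champ of [heat_op t g] is bounded by that of [g] because
   translations commute with the semigroup. *)
Lemma local_poincare (g : G -> R) (C t : R) x : 0 <= t -> 0 <= C ->
  (forall y s, s \in S -> `|g (y + s) - g y| <= C) ->
  heat_op P t (fun y => g y ^+ 2) x - heat_op P t g x ^+ 2 <= C ^+ 2 * t.
Proof.
move=> t0 C0 hg.
(* [z u] is the variance of g under the kernel at time u. By [generator_sqr], its time derivative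
   exceeds its generator by exactly twice the carre du champ of [heat_op P u g], so Duhamel applies
   with K = C^2. *)
pose z u y := heat_op P u (fun y => g y ^+ 2) y - heat_op P u g y ^+ 2.
pose dz u y := markov_generator P (heat_op P u (fun y => g y ^+ 2)) y -
   2 * heat_op P u g y * markov_generator P (heat_op P u g) y.
have hz (u : R) y : is_derive u 1 (z^~ y) (dz u y).
  have h := is_deriveB (is_derive_heat_op Pst u (fun y => g y ^+ 2) y)
    (is_deriveX 2 (is_derive_heat_op Pst u g y)).
  by apply: is_derive_eq h _; rewrite /dz /GRing.scale/= expr1; congr (_ - _); ring.
have := heat_op_duhamel Pst (K := C ^+ 2) x t0 hz.
have -> : heat_op P t (z 0) x = 0.
  apply: big1 => y _; rewrite /z !heat_op0 subrr mulr0//.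
rewrite add0r; apply => u y /andP[u0 _].
rewrite /dz; have := generator_sqr (heat_op P u g) y.
have -> : markov_generator P (z u) y =
    markov_generator P (heat_op P u (fun y => g y ^+ 2)) y -
    markov_generator P (fun y => heat_op P u g y ^+ 2) y.
  by rewrite !cayley_generatorE -mulrBr -sumrB; congr (_ * _); apply: eq_bigr => s _; rewrite /z; ring.
suff : 2 * Gamma P (heat_op P u g) (heat_op P u g) y <= C ^+ 2 by lra.
rewrite cayley_GammaE mulVKf ?pnatr_eq0//.
rewrite ler_pdivrMl// /m mulr_natl -sumr_const; apply: ler_sum => s sS.
rewrite heat_op_add -heat_op_sub -expr2.
rewrite -[leLHS]real_normK ?num_real// lerXn2r ?nnegrE//.
rewrite ler_norml -(heat_op_cst u (- C) y) -{2}(heat_op_cst u C y).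
by apply/andP; split; apply: (heat_op_le Pst) => // w;
  have := hg w s sS; rewrite ler_norml => /andP[].
Qed.

Lemma sum_generator (f : G -> R) : \sum_x markov_generator P f x = 0.
Proof.
under eq_bigr do rewrite cayley_generatorE.
rewrite -mulr_sumr exchange_big/= big1 ?mulr0// => s _.
by rewrite sumrB sum_addr subrr.
Qed.

Lemma sum_Gamma (f : G -> R) :
  \sum_x Gamma P f f x = - \sum_x f x * markov_generator P f x.
Proof.
have := sum_generator (fun y => f y ^+ 2).
under eq_bigr do rewrite generator_sqr -mulrA.
rewrite big_split/= -!mulr_sumr; lra.
Qed.

(** A spectral gap of the symmetrised walk; the counting measure replaces the uniform law because
    the factor 1 / N cancels. *)
Definition poincare (lambda : R) := forall v : G -> R, \sum_x v x = 0 ->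
  lambda * \sum_x v x ^+ 2 <= \sum_x Gamma P v v x.

(** By [sum_Gamma] the squared norm decreases at twice the energy, so the gap makes its product with
    exp(2 lambda u) nonincreasing; the mean stays zero by [sum_heat_op]. *)
Lemma heat_op_l2_decay (lambda t : R) (v : G -> R) :
  poincare lambda -> 0 <= t -> \sum_x v x = 0 ->
  \sum_x heat_op P t v x ^+ 2 <= expR (- (2 * lambda * t)) * \sum_x v x ^+ 2.
Proof.
move=> gap t0 v0.
pose F u := expR (0 + 2 * lambda * u) * \sum_x heat_op P u v x ^+ 2.
pose E u := \sum_x heat_op P u v x ^+ 2.
pose D u := \sum_x Gamma P (heat_op P u v) (heat_op P u v) x.
have hF (u : R) : is_derive u 1 F (expR (2 * lambda * u) * (2 * (lambda * E u - D u))).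
  have h1 := is_derive_sum_fin (F := fun x u => heat_op P u v x ^+ 2)
    (fun x => is_deriveX 2 (is_derive_heat_op Pst u v x)).
  have h := is_derive_mul (is_derive_affine (is_derive_expR (0 + 2 * lambda * u))) h1.
  apply: is_derive_eq h _; rewrite add0r.
  have -> : \sum_i (2 * heat_op P u v i ^+ 2.-1) *:
      markov_generator P (heat_op P u v) i = - (2 * D u).
    rewrite /D sum_Gamma mulrN opprK mulr_sumr; apply: eq_bigr => x _.
    by rewrite /GRing.scale/= expr1; ring.
  by rewrite /E; ring.
have h : F t - F 0 <= 0 * (t - 0).
  apply: is_derive_le t0 hF _ => u /andP[u0 _].
  rewrite pmulr_rle0 ?expR_gt0// pmulr_rle0 ?ltr0n// subr_le0 gap//.
  by rewrite sum_heat_op.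
move: h; rewrite mul0r /F mulr0 !add0r expR0 mul1r subr_le0.
have -> : \sum_x heat_op P 0 v x ^+ 2 = \sum_x v x ^+ 2.
  by apply: eq_bigr => x _; rewrite heat_op0.
by rewrite -ler_pdivlMl ?expR_gt0// expRN.
Qed.

(** Since x + s + r = x + r + s, the difference of the two sides at kappa = 0 is 1 / (4 m^2) times a
    sum of squares of the second differences of f along pairs of generators. *)
Lemma bakry_emery_ge0 : (0 <= bakry_emery P)%E.
Proof.
apply: ereal_sup_ubound; exists 0 => // f x; rewrite mul0r addr0.
rewrite cayley_GammaE [in leRHS]cayley_generatorE.
apply: ler_wpM2l; first by rewrite invr_ge0.
apply: ler_wpM2l; first by rewrite invr_ge0 ltW.
rewrite -subr_ge0.
under [X in _ - X]eq_bigr do rewrite !cayley_generatorE -mulrBr -sumrB mulrCA.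
rewrite -[X in _ - X]mulr_sumr.
under [X in X - _]eq_bigr do rewrite !cayley_GammaE -mulrBr -mulrBr -sumrB.
rewrite -!mulr_sumr exchange_big/=.
rewrite mulrCA -mulrBr; apply: mulr_ge0; first by rewrite invr_ge0 ltW.
rewrite mulr_sumr -sumrB; apply: sumr_ge0 => s _.
rewrite mulr_sumr mulr_sumr -sumrB; apply: sumr_ge0 => r _.
rewrite [x + r + s]addrAC.
have := sqr_ge0 (f (x + s + r) - f (x + r) - (f (x + s) - f x)); lra.
Qed.

End cayley_walk.

(** * From the variance of the log-density to mixing *)
(** With total mass zero the positive and negative parts have equal mass, and the sum over A is at
    most the positive part. *)
Lemma sum_cond_le_half_norm (R : realType) (X : finType) (h : X -> R) (A : pred X) :
  \sum_x h x = 0 -> \sum_(x | A x) h x <= 2^-1 * \sum_x `|h x|.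
Proof.
rewrite (bigID A)/= => h0; rewrite [in leRHS](bigID A)/=.
have h1 : \sum_(x | A x) h x <= \sum_(x | A x) `|h x|.
  by apply: ler_sum => x _; exact: ler_norm.
have h2 : - \sum_(x | ~~ A x) h x <= \sum_(x | ~~ A x) `|h x|.
  by rewrite -sumrN; apply: ler_sum => x _; rewrite -normrN; exact: ler_norm.
lra.
Qed.

(* A total variation distance below [1 - eps] leaves mass [eps / 2] where the
   density is at most [2 / eps]; by Chebyshev the mean of the log-density is
   then small, and by Chebyshev again so is its upper tail. *)
Lemma log_density_tail (R : realType) (X : finType) (h : X -> R) (eps V : R) :
  0 < eps -> 0 < V -> (forall x, 0 < h x) -> \sum_x h x = 1 ->
  let g x := ln (#|X|%:R * h x) in
  \sum_x h x * g x ^+ 2 - (\sum_x h x * g x) ^+ 2 <= V ->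
  2^-1 * \sum_x `|h x - #|X|%:R^-1| <= 1 - eps ->
  \sum_(x | ln (2 / eps) + 2 * Num.sqrt (2 * V / eps) < g x) h x <= eps / 2.
Proof.
move=> e0 V0 h0 h1 g hV hTV.
(* [r] makes the Chebyshev bound V / r^2 equal to eps / 2. *)
set b := ln (2 / eps); set r := Num.sqrt (2 * V / eps).
have q0 : 0 < 2 * V / eps by rewrite divr_gt0 ?mulr_gt0.
have r0 : 0 < r by rewrite sqrtr_gt0.
have r2 : r ^+ 2 = 2 * V / eps by rewrite sqr_sqrtr// ltW.
have [x0 _] : exists x0 : X, true.
  have : \sum_x h x != 0 by rewrite h1 oner_neq0.
  by case: (pickP (fun _ : X => true)) => [x0|n0]; [exists x0|rewrite big_pred0// eqxx].
have N0 : (0 : R) < #|X|%:R by rewrite ltr0n; apply/card_gt0P; exists x0.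
pose D := \sum_x h x * g x.
have hVD : \sum_x h x * (g x - D) ^+ 2 <= V.
  apply: le_trans hV; rewrite le_eqVlt; apply/orP; left; apply/eqP.
  transitivity (\sum_x (h x * g x ^+ 2 - 2 * D * (h x * g x) + D ^+ 2 * h x)).
    by apply: eq_bigr => x _; ring.
  by rewrite big_split/= sumrB -!mulr_sumr h1 -/D; ring.
have cheb (A : pred X) a : 0 <= a -> (forall x, A x -> a <= `|g x - D|) ->
    a ^+ 2 * \sum_(x | A x) h x <= V.
  move=> a0 hA; apply: le_trans hVD.
  rewrite mulr_sumr [leRHS](bigID A)/= -[leLHS]addr0; apply: lerD.
    apply: ler_sum => x Ax; rewrite mulrC ler_wpM2l ?(ltW (h0 x))//.
    by rewrite -[leRHS]real_normK ?num_real// lerXn2r ?nnegrE ?hA.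
  by apply: sumr_ge0 => x _; rewrite mulr_ge0 ?sqr_ge0 ?ltW.
(* Where g > b, the density relative to uniform exceeds 2 / eps, so this set has uniform mass at
   most eps / 2; the total variation bound adds at most 1 - eps. *)
have hb : \sum_(x | b < g x) h x <= 1 - eps / 2.
  have e1 : \sum_(x | b < g x) (h x - #|X|%:R^-1) <= 1 - eps.
    apply: le_trans hTV; apply: sum_cond_le_half_norm.
    by rewrite sumrB h1 sum_const_fin mulfV ?gt_eqF// subrr.
  have e2 : \sum_(x | b < g x) #|X|%:R^-1 <= eps / 2.
    have -> : eps / 2 = \sum_x eps / 2 * h x by rewrite -mulr_sumr h1 mulr1.
    rewrite [leRHS](bigID (fun x => b < g x))/=.
    rewrite -[leLHS]addr0; apply: lerD; last first.
      apply: sumr_ge0 => x _; apply: mulr_ge0; last exact/ltW/h0.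
      by rewrite divr_ge0 ?ltW.
    apply: ler_sum => x; rewrite /b /g ltr_ln ?posrE ?divr_gt0 ?mulr_gt0// => bx.
    rewrite -(ler_pM2l N0) mulfV ?gt_eqF//.
    move: bx; rewrite ltr_pdivrMr// => bx; lra.
  move: e1; rewrite sumrB; lra.
(* Otherwise the mass of at least eps / 2 with g <= b would lie more than r below the mean, against
   Chebyshev. *)
have hDb : D <= b + r.
  rewrite leNgt; apply/negP => Dbr.
  have := @cheb (fun x => ~~ (b < g x)) (D - b) _ _.
  rewrite subr_ge0 => /(_ _ _)/wrap[]; first by lra.
    move=> x; rewrite -leNgt => gb; rewrite distrC ger0_norm; lra.
  have hm : eps / 2 <= \sum_(x | ~~ (b < g x)) h x.
    by move: h1; rewrite (bigID (fun x => b < g x))/=; lra.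
  apply/negP; rewrite -ltNge.
  apply: (@lt_le_trans _ _ ((D - b) ^+ 2 * (eps / 2))); last first.
    by rewrite ler_wpM2l ?sqr_ge0.
  have -> : V = r ^+ 2 * (eps / 2) by rewrite r2; field; rewrite gt_eqF.
  by rewrite ltr_pM2r ?divr_gt0// ltrXn2r ?nnegrE//; lra.
have := @cheb (fun x => b + 2 * r < g x) r (ltW r0) _.
move=> /(_ _)/wrap[].
  move=> x gx; apply: le_trans (ler_norm _); lra.
rewrite r2 -ler_pdivlMl// => /le_trans; apply.
by rewrite le_eqVlt; apply/orP; left; apply/eqP; field; rewrite !gt_eqF.
Qed.

Section cayley_mixing.
Variables (R : realType) (G : finZmodType) (S : {set G}).
Hypothesis S_neq0 : (0 < #|S|)%N.

Let P := @cayley_kernel R G S.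
Let N : R := #|G|%:R.
Let N_gt0 : 0 < N. Proof. by rewrite ltr0n; apply/card_gt0P; exists 0. Qed.
Let Pst : stochastic P. Proof. exact: cayley_stochastic. Qed.

(** As a function of its starting point, the kernel into 0 is [heat_op] of an indicator, so the
    semigroup acts on it directly; by translation its distance to uniformity is that of the law from
    any start. *)
Definition unif_tv (t : R) : R :=
  2^-1 * \sum_x `|heat_kernel P t x 0 - N^-1|.

Lemma tv_heat_unif t x :
  tv_dist (heat_kernel P t x) (fun=> N^-1) = unif_tv t.
Proof.
rewrite /tv_dist /unif_tv; congr (_ * _).
rewrite [RHS](reindex_inj (inj_comp (addrI x) (@oppr_inj G)))/=.
by apply: eq_bigr => y _; rewrite (heat_kernel_sub S t x y).
Qed.

Lemma heat_kernel_indicE t x : heat_kernel P t x 0 = heat_op P t (fun y => (y == 0)%:R) x.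
Proof.
rewrite /heat_op (bigD1 0)//= eqxx mulr1 big1 ?addr0// => y /negbTE ->.
by rewrite mulr0.
Qed.

Lemma heat_kernel_sum0 t : \sum_x heat_kernel P t x 0 = 1.
Proof.
under eq_bigr do rewrite heat_kernel_indicE.
by rewrite sum_heat_op// (bigD1 0)//= eqxx big1 ?addr0// => y /negbTE ->.
Qed.

Lemma heat_op_norm_sum_le (lambda u : R) (v : G -> R) :
  poincare S lambda -> 0 <= u -> \sum_x v x = 0 ->
  \sum_x `|heat_op P u v x| <= expR (- (lambda * u)) * Num.sqrt (N * \sum_x v x ^+ 2).
Proof.
move=> gap u0 v0.
have n0 : 0 <= \sum_x v x ^+ 2 by apply: sumr_ge0 => x _; exact: sqr_ge0.
rewrite -(@ler_pXn2r _ 2)//; first last.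
- by rewrite nnegrE mulr_ge0 ?expR_ge0 ?sqrtr_ge0.
- by rewrite nnegrE sumr_ge0.
rewrite exprMn sqr_sqrtr ?mulr_ge0 ?(ltW N_gt0)//.
apply: le_trans (sum_sqr_le _) _; rewrite mulrCA ler_wpM2l ?(ltW N_gt0)//.
apply: le_trans (heat_op_l2_decay _ gap u0 v0) _ => //.
by rewrite ler_wpM2r// -expRM_natl -mulr_natl mulrN mulrA.
Qed.

(* Split [heat_kernel P t] at the density level [expR M]: the bounded part
   relaxes in L^2, the rest has mass at most [eps / 2]. *)
Lemma unif_tv_relax (lambda t u M eps : R) : poincare S lambda ->
  0 <= t -> 0 <= u -> 0 < eps ->
  \sum_(x | M < ln (N * heat_kernel P t x 0)) heat_kernel P t x 0 <= eps / 2 ->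
  (forall x, 0 < heat_kernel P t x 0) ->
  M / 2 - lambda * u <= ln eps ->
  unif_tv (t + u) <= eps.
Proof.
move=> gap t0 u0 e0 tail h0 hu.
pose h x := heat_kernel P t x 0.
have hpos x : 0 < h x by exact: h0.
pose f x := if M < ln (N * h x) then 0 else h x.
pose a := \sum_x f x.
pose v x := f x - a / N.
have hf0 x : 0 <= h x - f x.
  by rewrite /f; case: ifP => _; rewrite ?subr0 ?subrr//; exact/ltW/h0.
have f0 x : 0 <= f x by rewrite /f; case: ifP => // _; exact/ltW/h0.
have fM x : f x <= expR M / N.
  rewrite /f; case: ifP => [_|/negbT]; first by rewrite divr_ge0 ?expR_ge0 ?ltW.
  rewrite -leNgt => hM; rewrite ler_pdivlMr// mulrC.
  by move: hM; rewrite -ler_expR lnK// posrE mulr_gt0.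
have sumhf : \sum_x (h x - f x) <= eps / 2.
  apply: le_trans tail; rewrite [leRHS]big_mkcond/=; apply: ler_sum => x _.
  by rewrite /f -/(h x); case: ifP; rewrite ?subr0 ?subrr.
have ha : 1 - a <= eps / 2 by move: sumhf; rewrite sumrB /h heat_kernel_sum0.
have a1 : a <= 1.
  by rewrite -(heat_kernel_sum0 t); apply: ler_sum => x _; rewrite -subr_ge0 hf0.
have a0 : 0 <= a by apply: sumr_ge0 => x _; exact: f0.
have v0 : \sum_x v x = 0.
  by rewrite sumrB sum_const_fin mulrCA mulfV ?gt_eqF// mulr1 subrr.
(* Centring only lowers the L^2 norm, and f is at most exp(M) / N with total mass a <= 1. *)
have v2 : N * \sum_x v x ^+ 2 <= expR M.
  have : \sum_x v x ^+ 2 <= \sum_x f x ^+ 2.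
    rewrite -subr_ge0 -sumrB.
    have -> : \sum_x (f x ^+ 2 - v x ^+ 2) = \sum_x (2 * (a / N) * f x - (a / N) ^+ 2).
      by apply: eq_bigr => x _; rewrite /v; ring.
    rewrite sumrB -mulr_sumr sum_const_fin -/N -/a.
    have -> : 2 * (a / N) * a - N * (a / N) ^+ 2 = a ^+ 2 / N by field; rewrite gt_eqF.
    by rewrite divr_ge0 ?sqr_ge0 ?ltW.
  have : \sum_x f x ^+ 2 <= expR M / N.
    apply: (@le_trans _ _ (expR M / N * a)).
      rewrite mulr_sumr; apply: ler_sum => x _.
      by rewrite expr2 ler_wpM2r.
    by rewrite -[leRHS]mulr1 ler_wpM2l// divr_ge0 ?expR_ge0 ?ltW.
  move=> h1 h2; rewrite mulrC -ler_pdivlMr//; exact: le_trans h1.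
(* The three terms have L^1 norms at most eps, eps / 2 and eps / 2, and [unif_tv] halves their
   sum. *)
have split x : heat_kernel P (t + u) x 0 - N^-1 =
    heat_op P u v x + heat_op P u (fun y => h y - f y) x - (1 - a) / N.
  rewrite heat_kernel_indicE [t + u]addrC (heat_opD Pst)//.
  rewrite (_ : heat_op P t _ = h); last first.
    by apply/funext => y; rewrite -heat_kernel_indicE.
  rewrite (_ : heat_op P u v x = heat_op P u f x - a / N); last first.
    by rewrite heat_op_sub heat_op_cst.
  by rewrite heat_op_sub; ring.
rewrite /unif_tv.
have : \sum_x `|heat_kernel P (t + u) x 0 - N^-1| <=
    \sum_x `|heat_op P u v x| + \sum_x heat_op P u (fun y => h y - f y) x + (1 - a).
  have -> : 1 - a = \sum_(x : G) (1 - a) / N.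
    by rewrite sum_const_fin mulrCA mulfV ?gt_eqF// mulr1.
  rewrite -!big_split/=; apply: ler_sum => x _; rewrite split.
  apply: le_trans (ler_normB _ _) _; apply: lerD.
    apply: le_trans (ler_normD _ _) _; rewrite lerD2l ger0_norm//.
    by apply: sumr_ge0 => y _; rewrite mulr_ge0 ?heat_kernel_ge0.
  by rewrite ger0_norm// divr_ge0 ?subr_ge0// ltW.
rewrite sum_heat_op// => hsum.
have hl2 := heat_op_norm_sum_le gap u0 v0.
have : expR (- (lambda * u)) * Num.sqrt (N * \sum_x v x ^+ 2) <= eps.
  apply: (@le_trans _ _ (expR (- (lambda * u)) * expR (M / 2))).
    rewrite ler_wpM2l ?expR_ge0// -(@ler_pXn2r _ 2)// ?nnegrE ?expR_ge0 ?sqrtr_ge0//.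
    rewrite sqr_sqrtr ?mulr_ge0 ?(ltW N_gt0) ?sumr_ge0// => [|x _]; last exact: sqr_ge0.
    by rewrite -expRM_natl [_ * (M / 2)]mulrC divfK.
  rewrite -expRD -[leRHS]lnK ?posrE// ler_expR; lra.
lra.
Qed.

(** The local Poincare inequality supplies V = C^2 t. The last hypothesis is M / 2 - lambda u <= ln
    eps at the level M of [log_density_tail]. *)
Lemma unif_tv_window (lambda t u C eps : R) : poincare S lambda ->
  0 < t -> 0 <= u -> 0 < eps -> 0 < C ->
  (forall x, 0 < heat_kernel P t x 0) ->
  (forall x s, s \in S ->
    `|ln (heat_kernel P t (x + s) 0) - ln (heat_kernel P t x 0)| <= C) ->
  unif_tv t <= 1 - eps ->
  ln (2 / eps) / 2 + Num.sqrt (2 * (C ^+ 2 * t) / eps) - lambda * u <= ln eps ->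
  unif_tv (t + u) <= eps.
Proof.
move=> gap t0 u0 e0 C0 h0 hC htv hu.
apply: (@unif_tv_relax lambda t u
  (ln (2 / eps) + 2 * Num.sqrt (2 * (C ^+ 2 * t) / eps)) eps) => //; [exact: ltW| |lra].
apply: (@log_density_tail _ _ (fun x => heat_kernel P t x 0)) => //.
- by rewrite mulr_gt0// exprn_gt0.
- exact: heat_kernel_sum0.
(* The local Poincare inequality integrates against the law started at 0, whereas h is the kernel
   into 0; the reflection x -> -x exchanges the two. *)
pose g x := ln (N * heat_kernel P t (- x) 0).
have hg y s : s \in S -> `|g (y + s) - g y| <= C.
  have gE z : g z = ln N + ln (heat_kernel P t (- z) 0).
    by rewrite /g lnM// posrE// h0.
  move=> sS; rewrite !gE.
  have := hC (- y - s) s sS; rewrite subrK distrC -opprD.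
  by congr (`|_| <= _); ring.
have := local_poincare S_neq0 0 (ltW t0) (ltW C0) hg.
have heat0 (F : G -> R) : heat_op P t F 0 = \sum_x heat_kernel P t x 0 * F (- x).
  rewrite /heat_op (reindex_inj (@oppr_inj G))/=; apply: eq_bigr => x _.
  by rewrite (heat_kernel_sub S t 0 (- x)) sub0r opprK.
rewrite !heat0.
by under eq_bigr do rewrite /g opprK; under [X in _ - X ^+ 2 <= _]eq_bigr do rewrite /g opprK.
Qed.

End cayley_mixing.

(** * Regularity of the log-density along a generator *)
Section poisson_mod3.
Variable R : realType.

Let Q := @cayley_kernel R 'Z_3 [set (1%R : 'Z_3)]%SET.
Let S1 : (0 < #|[set (1%R : 'Z_3)]%SET|)%N. Proof. by rewrite cards1. Qed.
Let Qst : stochastic Q. Proof. exact: cayley_stochastic. Qed.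

(* The law modulo 3 of a Poisson variable of mean [t]. *)
Definition poisson3 (t : R) (a : 'Z_3) : R := heat_kernel Q t 0 a.

Lemma poisson3_le1 t a : 0 <= t -> poisson3 t a <= 1.
Proof.
move=> t0; rewrite -(heat_kernel_sum Qst t 0) (bigD1 a)//= lerDl.
by apply: sumr_ge0 => b _; exact: heat_kernel_ge0.
Qed.

Lemma is_derive_poisson3 (t : R) a :
  is_derive t 1 (poisson3^~ a) (poisson3 t (a - 1) - poisson3 t a).
Proof.
apply: is_derive_eq (is_derive_heatr Qst t 0 a) _; congr (_ - _).
by rewrite (cayley_sum_sub [set (1%R : 'Z_3)]%SET a) cards1 invr1 mul1r big_set1.
Qed.

Lemma poisson3_0 a : poisson3 0 a = (0 == a)%:R.
Proof. exact: heat_kernel0. Qed.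

Let kpow_cycle k (y : 'Z_3) : kpow Q k y (y + k%:R) = 1.
Proof.
elim: k y => [|k IH] y /=; first by rewrite addr0 eqxx.
by rewrite (cayley_sum [set (1%R : 'Z_3)]%SET y) cards1 invr1 mul1r big_set1 -natr1 addrCA addrC IH.
Qed.

(** Whatever the residue at time t - t0, at most two further jumps lead to a, with probability at
    least exp(- t0) t0^2 / 2; and exp(- t0) / 2 >= exp(- 2) because t0 <= 1. *)
Lemma poisson3_ge (t0 t : R) a : 0 < t0 <= 1 -> t0 <= t ->
  expR (- 2) * t0 ^+ 2 <= poisson3 t a.
Proof.
move=> /andP[t00 t01] t0t.
rewrite /poisson3 (heat_kernel_sub [set (1%R : 'Z_3)]%SET) heat_kernel_indicE.
rewrite -(subrK t0 t) (heat_opD Qst) ?subr_ge0//.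
rewrite -(heat_op_cst S1 (t - t0) (expR (- 2) * t0 ^+ 2) (0 - a)).
apply: (heat_op_le Qst); rewrite ?subr_ge0// => y.
rewrite -heat_kernel_indicE.
apply: le_trans (heat_kernel_ge Qst y 0 (- y) (ltW t00)).
have -> : kpow Q (- y) y 0 = 1.
  by rewrite -[RHS](kpow_cycle (- y) y) natr_Zp subrr.
rewrite mul1r.
have k2 : (nat_of_ord (- y) <= 2)%N by rewrite -ltnS; exact: (ltn_ord (- y)).
have e2 : expR (- 2) <= expR (- t0) / 2 :> R.
  rewrite ler_pdivlMr// -[X in _ * X <= _]lnK ?posrE// -expRD ler_expR.
  have : ln 2 <= 1 :> R by rewrite -[leRHS]expRK ler_ln ?posrE ?expR_gt0// expR_ge1Dx.
  lra.
have fac : 2^-1 <= ((- y : 'Z_3)`!%:R)^-1 :> R.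
  rewrite lef_pV2 ?posrE ?ltr0n ?fact_gt0// ler_nat.
  by move: k2; case: (nat_of_ord (- y)) => [|[|[|]]].
have te : t0 ^+ 2 <= t0 ^+ (- y : 'Z_3) by rewrite ler_wiXn2l// ltW.
apply: (@le_trans _ _ (expR (- t0) / 2 * t0 ^+ 2)).
  by rewrite ler_wpM2r// exprn_ge0// ltW.
rewrite -mulrA ler_wpM2l ?expR_ge0// ler_pM// ?invr_ge0// exprn_ge0// ltW//.
Qed.

End poisson_mod3.

Section one_generator.
Variables (R : realType) (G : finZmodType) (S : {set G}) (s : G).
Hypotheses (S_gt1 : (1 < #|S|)%N) (sS : s \in S) (s3 : s *+ 3 = 0).

Let P := @cayley_kernel R G S.
Let m : R := #|S|%:R.

Let Pst : stochastic P. Proof. by apply: cayley_stochastic; exact: ltnW. Qed.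

Let mulrn_Z3 (a b : 'Z_3) : s *+ (a + b)%R = s *+ a + s *+ b.
Proof.
rewrite -mulrnDr [X in _ = s *+ X](divn_eq (a + b) 3) mulrnDr mulnC mulrnA s3 mul0rn add0r.
by [].
Qed.

Let sum_poisson3_shift (t : R) (F : G -> R) x :
  \sum_a poisson3 t (a - 1) * F (x + s *+ a) =
  \sum_a poisson3 t a * F (x + s + s *+ a).
Proof.
rewrite -(sum_addr _ 1); apply: eq_bigr => a _; rewrite addrK mulrn_Z3.
by rewrite -addrA [s + _]addrC.
Qed.

(* [S :\ s] runs at the slower speed [(m - 1) / m]. *)
Lemma heat_kernel_factor (t : R) : 0 <= t ->
  exists2 psi : G -> R, (forall x, 0 <= psi x) &
    forall x, heat_kernel P t x 0 = \sum_a poisson3 (m^-1 * t) a * psi (x + s *+ a).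
Proof.
move=> t0.
have cS : #|S| = #|(S :\ s)%SET|.+1 by rewrite (cardsD1 s S) sS.
have S'0 : (0 < #|(S :\ s)%SET|)%N by move: S_gt1; rewrite cS ltnS.
pose P' := @cayley_kernel R G (S :\ s)%SET.
have P'st : stochastic P' by exact: cayley_stochastic.
pose k : R := m^-1 * #|(S :\ s)%SET|%:R.
have k0 : 0 <= k by rewrite mulr_ge0// invr_ge0.
pose f (y : G) : R := (y == 0)%:R.
exists (heat_op P' (k * t) f).
  by move=> x; apply: sumr_ge0 => y _; rewrite mulr_ge0 ?heat_kernel_ge0// mulr_ge0.
(* The law of the jumps along s combined with the kernel of the other generators. By commutativity
   it solves the heat equation of [P], and uniqueness identifies it. The added zeros match
   [is_derive_affine]. *)
pose w u x := \sum_a poisson3 (0 + m^-1 * u) a * heat_op P' (0 + k * u) f (x + s *+ a).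
have hw (u : R) x : is_derive u 1 (w^~ x) (markov_generator P (w u) x).
  have h := is_derive_sum_fin (fun a => is_derive_mul
    (is_derive_affine (is_derive_poisson3 (0 + m^-1 * u) a))
    (is_derive_affine (is_derive_heat_op P'st (0 + k * u) f (x + s *+ a)))).
  apply: is_derive_eq h _; rewrite cayley_generatorE (bigD1 s)//= mulrDr big_split/=.
  congr (_ + _).
    rewrite /w -sum_poisson3_shift -sumrB mulr_sumr; apply: eq_bigr => a _; ring.
  rewrite (_ : \sum_(i in S | i != s) _ =
      \sum_(i in (S :\ s)%SET) (w u (x + i) - w u x)); last first.
    by apply: eq_bigl => i; rewrite !inE andbC.
  rewrite /w.
  under [in RHS]eq_bigr do rewrite -sumrB.
  rewrite exchange_big mulr_sumr/=; apply: eq_bigr => a _.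
  under [in RHS]eq_bigr do rewrite -mulrBr.
  rewrite -mulr_sumr cayley_generatorE [RHS]mulrCA; congr (_ * _).
  rewrite mulrA /k mulfK ?gt_eqF ?ltr0n//; congr (_ * _).
  by apply: eq_bigr => r _; rewrite [x + r + _]addrAC.
move=> x; have := heat_op_unique Pst x t0 hw.
rewrite /w !add0r => ->; rewrite heat_kernel_indicE; congr heat_op.
apply/funext => y; rewrite (bigD1 0)//= !mulr0 poisson3_0 eqxx mul1r heat_op0 mulr0n addr0.
rewrite big1 ?addr0// => a; rewrite eq_sym poisson3_0 => /negbTE ->.
by rewrite mul0r.
Qed.

(** As 3 s = 0, the factorisations at x and x + s average the same three values of psi with weights
    between delta = exp(- 2) / m^2 and 1, so the kernels differ by a factor at most 1 / delta. The
    weight bound uses t / m >= 1 / m. *)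
Lemma ln_heat_kernel_step (t : R) x : 1 <= t ->
  (forall y, 0 < heat_kernel P t y 0) ->
  `|ln (heat_kernel P t (x + s) 0) - ln (heat_kernel P t x 0)| <= 2 + 2 * ln m.
Proof.
move=> t1 h0; have t0 : 0 <= t by exact: le_trans t1.
have m0 : 0 < m by rewrite ltr0n ltnW.
have [psi psi0 hE] := heat_kernel_factor t0.
have d0 := expR_gt0 (- 2 : R).
pose delta : R := expR (- 2) * (m^-1) ^+ 2.
have lb a : delta <= poisson3 (m^-1 * t) a.
  apply: poisson3_ge.
    by rewrite invr_gt0 m0 invf_le1// ler1n ltnW.
  by rewrite ler_peMr// invr_ge0 ltW.
have ub a : poisson3 (m^-1 * t) a <= 1.
  by apply: poisson3_le1; rewrite mulr_ge0// invr_ge0 ltW.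
have delta0 : 0 < delta by rewrite mulr_gt0// exprn_gt0// invr_gt0.
pose T := \sum_a psi (x + s *+ (a : 'Z_3)).
have hx : delta * T <= heat_kernel P t x 0 <= T.
  rewrite hE mulr_sumr; apply/andP; split; apply: ler_sum => a _.
    by rewrite ler_wpM2r.
  by rewrite -[leRHS]mul1r ler_wpM2r.
have hxs : delta * T <= heat_kernel P t (x + s) 0 <= T.
  rewrite hE -sum_poisson3_shift mulr_sumr; apply/andP; split; apply: ler_sum => a _.
    by rewrite ler_wpM2r.
  by rewrite -[leRHS]mul1r ler_wpM2r.
have lnd : ln delta = - (2 + 2 * ln m).
  rewrite lnM ?posrE ?exprn_gt0 ?invr_gt0// expRK lnXn ?invr_gt0// lnV ?posrE//.
  by rewrite -mulr_natl; ring.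
have step a b : 0 < a -> 0 < b -> delta * T <= a -> b <= T ->
    ln b - ln a <= 2 + 2 * ln m.
  move=> a0 b0 ha hb.
  have : ln (delta * b) <= ln a.
    rewrite ler_ln ?posrE ?(mulr_gt0 delta0 b0)//.
    by apply: le_trans ha; rewrite ler_wpM2l// ltW.
  rewrite lnM ?posrE// lnd; lra.
move: hx hxs => /andP[hx1 hx2] /andP[hxs1 hxs2].
have := step _ _ (h0 x) (h0 (x + s)) hx1 hxs2.
have := step _ _ (h0 (x + s)) (h0 x) hxs1 hx2.
by move=> h1 h2; rewrite ler_norml; apply/andP; split; lra.
Qed.

End one_generator.

(** * Characters of (Z/3)^d and the spectral gap *)
Section characters_mod3.
Variable R : realType.

(* Real and imaginary parts of the nontrivial character of Z/3. *)
Definition cos3 (u : 'Z_3) : R := if u == 0 then 1 else - 2^-1.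
Definition sin3 (u : 'Z_3) : R :=
  if u == 0 then 0 else if u == 1 then Num.sqrt 3 / 2 else - (Num.sqrt 3 / 2).

Lemma Z3_cases (u : 'Z_3) : [\/ u = 0, u = 1 | u = -1].
Proof.
case: u => [[|[|[|//]]] hu]; [apply: Or31|apply: Or32|apply: Or33]; exact: val_inj.
Qed.

Let sqrt3 : Num.sqrt (3 : R) ^+ 2 = 3. Proof. by rewrite sqr_sqrtr. Qed.

Lemma cos3B u v : cos3 (u - v) = cos3 u * cos3 v + sin3 u * sin3 v.
Proof.
have s3 := sqrt3; rewrite /cos3 /sin3.
by case: (Z3_cases u) => ->; case: (Z3_cases v) => -> /=; nra.
Qed.

Lemma cos3M u v : cos3 u * cos3 v = 2^-1 * (cos3 (u + v) + cos3 (u - v)).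
Proof.
by rewrite /cos3; case: (Z3_cases u) => ->; case: (Z3_cases v) => -> /=; lra.
Qed.

Lemma cos3_sum u : cos3 u + cos3 (u + 1) + cos3 (u + 1 + 1) = 0.
Proof. by rewrite /cos3; case: (Z3_cases u) => -> /=; lra. Qed.

End characters_mod3.

Section dual_group.
Variables (R : realType) (d : nat).
Implicit Types a x y z : Z3pow d.

Definition dotp a x : 'Z_3 := \sum_i (a : 'rV['Z_3]_d) 0 i * (x : 'rV['Z_3]_d) 0 i.

Lemma dotpC a x : dotp a x = dotp x a.
Proof. by apply: eq_bigr => i _; rewrite mulrC. Qed.

Lemma dotpDr a x y : dotp a (x + y) = dotp a x + dotp a y.
Proof. by rewrite /dotp -big_split/=; apply: eq_bigr => i _; rewrite mxE mulrDr. Qed.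

Lemma dotpNr a x : dotp a (- x) = - dotp a x.
Proof. by rewrite /dotp -sumrN; apply: eq_bigr => i _; rewrite mxE mulrN. Qed.

Lemma dotp0r a : dotp a 0 = 0.
Proof. by rewrite /dotp big1// => i _; rewrite mxE mulr0. Qed.

Lemma dotp_eq1 x : x != 0 -> exists a, dotp a x = 1.
Proof.
move=> x0; have [i xi] : exists i, (x : 'rV['Z_3]_d) 0 i != 0.
  apply/existsP; apply: contra_neqT x0 => /existsPn h.
  by apply/rowP => i; rewrite mxE; apply/eqP; have := h i; rewrite negbK.
(* A nonzero residue modulo 3 has square 1. *)
exists (((x : 'rV['Z_3]_d) 0 i *: delta_mx 0 i) : 'rV['Z_3]_d).
rewrite /dotp (bigD1 i)//= big1 ?addr0 => [|j ji].
  by rewrite !mxE !eqxx mulr1; case: (Z3_cases (x 0 i)) xi => ->//= _; exact: val_inj.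
by rewrite !mxE (negbTE ji) andbF mulr0 mul0r.
Qed.

(** Orthogonality of characters: for x nonzero, translating a by some b with [dotp b x = 1] permutes
    the sum while rotating each term through three residues whose cosines cancel. *)
Lemma sum_cos3_dotp x : \sum_a cos3 R (dotp a x) = (x == 0)%:R * #|Z3pow d|%:R.
Proof.
have [->|x0] := eqVneq x 0.
  rewrite mul1r -[RHS]mulr1 -sum_const_fin; apply: eq_bigr => a _.
  by rewrite dotp0r /cos3 eqxx.
rewrite mul0r; have [b hb] := dotp_eq1 x0.
have h1 := sum_addr (fun a => cos3 R (dotp a x)) b.
have h2 := sum_addr (fun a => cos3 R (dotp (a + b) x)) b.
have : \sum_a (cos3 R (dotp a x) + cos3 R (dotp (a + b) x) +
   cos3 R (dotp (a + b + b) x)) = 0.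
  by apply: big1 => a _; rewrite !(dotpC _ x) !dotpDr (dotpC x b) hb cos3_sum.
by rewrite !big_split/= h2 h1; lra.
Qed.

(** In Fourier space the energy of v weights the power at a by 1 minus this sum divided by |S|. *)
Definition spectral_bound (S : {set Z3pow d}) (rho : R) : Prop :=
  forall a, a != 0 -> \sum_(s in S) cos3 R (dotp a s) <= rho * #|S|%:R.

(** The squared modulus of the Fourier coefficient of v at a, as a real double sum. *)
Let power (v : Z3pow d -> R) a : R :=
  \sum_x \sum_y v x * v y * cos3 R (dotp a (x - y)).

Let power_ge0 v a : 0 <= power v a.
Proof.
rewrite /power (_ : \sum_x _ = (\sum_x v x * cos3 R (dotp a x)) ^+ 2 +
  (\sum_x v x * sin3 R (dotp a x)) ^+ 2) ?addr_ge0 ?sqr_ge0//.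
rewrite !expr2 !mulr_suml -big_split/=; apply: eq_bigr => x _.
rewrite !mulr_sumr -big_split/=; apply: eq_bigr => y _.
by rewrite dotpDr dotpNr cos3B; ring.
Qed.

(** Parseval for the autocorrelation of v at lag s. The product formula for cosines yields the lags
    s and -s, which agree by translation. *)
Let sum_power_cos3 (v : Z3pow d -> R) s :
  \sum_a power v a * cos3 R (dotp a s) = #|Z3pow d|%:R * \sum_x v x * v (x + s).
Proof.
pose I x y z : R := (x - y + z == 0)%:R.
transitivity (\sum_x \sum_y v x * v y *
    (2^-1 * (I x y s * #|Z3pow d|%:R + I x y (- s) * #|Z3pow d|%:R))).
  under eq_bigr do rewrite mulr_suml.
  rewrite exchange_big/=; apply: eq_bigr => x _.
  under eq_bigr do rewrite mulr_suml.
  rewrite exchange_big/=; apply: eq_bigr => y _.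
  rewrite /I -!sum_cos3_dotp -big_split/= 2!mulr_sumr; apply: eq_bigr => a _.
  by rewrite -mulrA cos3M !dotpDr !dotpNr.
have pick s' : \sum_x \sum_y v x * v y * I x y s' = \sum_x v x * v (x + s').
  apply: eq_bigr => x _; rewrite (bigD1 (x + s'))//= big1 ?addr0 => [|y].
    by rewrite /I opprD addrA subrr sub0r addNr eqxx mulr1.
  by rewrite /I addrAC subr_eq0 eq_sym => /negbTE ->; rewrite mulr0.
transitivity (2^-1 * #|Z3pow d|%:R *
    (\sum_x v x * v (x + s) + \sum_x v x * v (x + - s))).
  rewrite -!pick -big_split/= mulr_sumr; apply: eq_bigr => x _.
  by rewrite -big_split/= mulr_sumr; apply: eq_bigr => y _; ring.
have -> : \sum_x v x * v (x + - s) = \sum_x v x * v (x + s).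
  by rewrite -(sum_addr _ s); apply: eq_bigr => x _; rewrite addrK mulrC.
by field.
Qed.

(** Both sides are diagonal in Fourier space and are compared frequency by frequency; mean zero
    removes a = 0, where no bound is assumed. *)
Lemma spectral_bound_poincare (S : {set Z3pow d}) (rho : R) : (0 < #|S|)%N ->
  spectral_bound S rho -> poincare S (1 - rho).
Proof.
move=> S0 spec v v0.
have m0 : (0 : R) < #|S|%:R by rewrite ltr0n.
have N0 : (0 : R) < #|Z3pow d|%:R by rewrite ltr0n; apply/card_gt0P; exists 0.
have p0 : power v 0 = 0.
  rewrite /power; transitivity ((\sum_x v x) * (\sum_y v y)); last by rewrite v0 mul0r.
  rewrite mulr_suml; apply: eq_bigr => x _; rewrite mulr_sumr; apply: eq_bigr => y _.
  by rewrite dotpC dotp0r /cos3 eqxx mulr1.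
have sumv2 : #|Z3pow d|%:R * \sum_x v x ^+ 2 = \sum_a power v a.
  transitivity (#|Z3pow d|%:R * \sum_x v x * v (x + 0)).
    by congr (_ * _); apply: eq_bigr => x _; rewrite addr0.
  by rewrite -sum_power_cos3; apply: eq_bigr => a _; rewrite dotp0r /cos3 eqxx mulr1.
rewrite sum_Gamma// -(ler_pM2l N0).
have -> : - \sum_x v x * markov_generator (cayley_kernel R S) v x =
    \sum_x v x ^+ 2 - #|S|%:R^-1 * \sum_(s in S) \sum_x v x * v (x + s).
  rewrite exchange_big/= mulr_sumr -sumrN -sumrB; apply: eq_bigr => x _.
  rewrite cayley_generatorE sumrB sumr_const -mulr_sumr -mulr_natl.
  by field; rewrite gt_eqF.
rewrite mulrBr mulrCA sumv2.
have -> : #|Z3pow d|%:R * (#|S|%:R^-1 * \sum_(s in S) \sum_x v x * v (x + s)) =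
    \sum_a power v a * (#|S|%:R^-1 * \sum_(s in S) cos3 R (dotp a s)).
  rewrite mulrCA mulr_sumr; under eq_bigr do rewrite -sum_power_cos3.
  rewrite exchange_big/= mulr_sumr; apply: eq_bigr => a _.
  by rewrite -mulr_sumr mulrCA.
rewrite mulr_sumr -sumrB; apply: ler_sum => a _.
have [->|a0] := eqVneq a 0; first by rewrite p0 !mul0r mulr0 subr0.
rewrite mulrC -[X in _ <= X - _]mulr1 -mulrBr ler_wpM2l ?power_ge0// lerD2l lerN2.
by rewrite ler_pdivrMl// mulrC spec.
Qed.

End dual_group.

(** * Word balls and the lower bound on the mixing time *)

Section word_length.
Variables (R : realType) (G : finZmodType) (S : {set G}).
Hypothesis S_neq0 : (0 < #|S|)%N.
Let P := @cayley_kernel R G S.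
Let Pst : stochastic P. Proof. exact: cayley_stochastic. Qed.

Fixpoint word_ball (k : nat) : {set G} :=
  if k is k'.+1 then
    (word_ball k' :|: [set p.1 + p.2 | p in finset.setX (word_ball k') S])%SET
  else [set 0]%SET.

Lemma card_word_ball k : (#|word_ball k| <= #|S|.+1 ^ k)%N.
Proof.
elim: k => [|k IH]; first by rewrite cards1.
rewrite expnS; apply: leq_trans (leq_mul (leqnn _) IH).
apply: leq_trans (leq_card_setU _ _) _; rewrite mulSn leq_add2l.
by apply: leq_trans (leq_imset_card _ _) _; rewrite cardsX mulnC.
Qed.

Lemma word_ballS k x s : s \in S -> x \in word_ball k -> x + s \in word_ball k.+1.
Proof.
move=> sS xk /=; rewrite inE; apply/orP; right.
by apply/imsetP; exists (x, s) => //; rewrite inE/= xk sS.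
Qed.

Lemma word_ball_sub j k x : (j <= k)%N -> x \in word_ball j -> x \in word_ball k.
Proof.
elim: k => [|k IH]; first by rewrite leqn0 => /eqP ->.
rewrite leq_eqVlt => /orP[/eqP -> //|jk xj].
by rewrite /= inE IH.
Qed.

(* The word length truncated at [k]; it grows by at most one per jump. *)
Definition word_length (k : nat) (x : G) : R :=
  \sum_(j < k) (x \notin word_ball j)%:R.

Lemma word_length_step k x s : s \in S -> word_length k (x + s) <= word_length k x + 1.
Proof.
case: k => [|k] sS; first by rewrite /word_length !big_ord0 add0r.
have first_le1 : (x + s \notin word_ball 0)%:R <= 1 :> R by rewrite lern1 leq_b1.
rewrite /word_length big_ord_recl [in leRHS]big_ord_recr/= [leLHS]addrC.
apply: lerD => //; apply: ler_wpDr => //.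
apply: ler_sum => j _; rewrite ler_nat.
case: (boolP (x \in word_ball j)) => xj; last by rewrite leq_b1.
by rewrite (word_ballS sS xj).
Qed.

(** Jumps occur at rate one and lengthen the word by at most one, so the mean length has derivative
    at most 1. *)
Lemma heat_op_word_length_le (t : R) k : 0 <= t -> heat_op P t (word_length k) 0 <= t.
Proof.
move=> t0; have wl0 : word_length k 0 = 0.
  by rewrite /word_length big1// => j _; rewrite (@word_ball_sub 0 j)// inE.
have := is_derive_le (K := 1) t0 (fun u => is_derive_heat_op Pst u (word_length k) 0).
rewrite heat_op0 wl0 !subr0 mul1r.
apply=> u /andP[u0 _]; rewrite cayley_generatorE ler_pdivrMl ?ltr0n// mulr1.
rewrite -sum1_card natr_sum; apply: ler_sum => s sS.
rewrite heat_op_add -heat_op_sub -(heat_op_cst S_neq0 u 1 0).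
by apply: (heat_op_le Pst) => // y; rewrite lerBlDl word_length_step.
Qed.

(** The mass outside the ball of radius k is bounded by Markov's inequality for the word length, the
    mass inside by 1 - eps plus the uniform mass of the ball. *)
Lemma unif_tv_lower (t eps : R) k : 0 <= t -> unif_tv S t <= 1 - eps ->
  eps <= t / k.+1%:R + #|S|.+1%:R ^+ k / #|G|%:R.
Proof.
move=> t0; rewrite -(tv_heat_unif S t 0) /tv_dist => htv.
have k0 : (0 : R) < k.+1%:R by [].
have N0 : (0 : R) < #|G|%:R by rewrite ltr0n; apply/card_gt0P; exists 0.
have h0 y : 0 <= heat_kernel P t 0 y by exact: heat_kernel_ge0.
(* Outside the ball of radius k all k + 1 terms of [word_length k.+1] equal 1. *)
have far : \sum_(y | y \notin word_ball k) heat_kernel P t 0 y <= t / k.+1%:R.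
  rewrite ler_pdivlMr//; apply: le_trans (heat_op_word_length_le k.+1 t0).
  rewrite mulr_suml big_mkcond/=; apply: ler_sum => y _.
  case: ifPn => [yk|_]; last by rewrite mulr_ge0// sumr_ge0.
  rewrite ler_wpM2l// /word_length -[X in X%:R <= _]card_ord -sum1_card natr_sum.
  apply: ler_sum => j _; rewrite ler1n lt0b.
  by apply: contraNN yk; apply: word_ball_sub; rewrite -ltnS.
have near : \sum_(y | y \in word_ball k) (heat_kernel P t 0 y - #|G|%:R^-1) <= 1 - eps.
  apply: le_trans htv; apply: sum_cond_le_half_norm.
  by rewrite sumrB (heat_kernel_sum Pst) sum_const_fin mulfV ?gt_eqF// subrr.
have small : \sum_(y | y \in word_ball k) #|G|%:R^-1 <= #|S|.+1%:R ^+ k / #|G|%:R :> R.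
  rewrite sum_const_set ler_wpM2r ?invr_ge0// -natrX ler_nat.
  exact: card_word_ball.
have := heat_kernel_sum Pst t 0; rewrite (bigID (fun y => y \in word_ball k))/= => h1.
move: near far small h1; rewrite sumrB.
set X1 := t / _; set X2 := _ ^+ k / _; lra.
Qed.

End word_length.

(** * Consequences of the Poincare inequality for the chain *)

Section poincare_consequences.
Variables (R : realType) (G : finZmodType) (S : {set G}) (lambda : R).
Hypotheses (S_neq0 : (0 < #|S|)%N) (lambda0 : 0 < lambda).
Hypothesis gap : poincare S lambda.
Let P := @cayley_kernel R G S.
Let N : R := #|G|%:R.
Let N_gt0 : 0 < N. Proof. by rewrite ltr0n; apply/card_gt0P; exists 0. Qed.
Let Pst : stochastic P. Proof. exact: cayley_stochastic. Qed.

Lemma poincare_eq0 (v : G -> R) :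
  \sum_x v x = 0 -> \sum_x Gamma P v v x <= 0 -> forall x, v x = 0.
Proof.
move=> v0 g0 x; have := le_trans (gap v0) g0.
rewrite pmulr_rle0// => h.
have /eqP : \sum_x v x ^+ 2 == 0.
  by rewrite eq_le h sumr_ge0// => y _; exact: sqr_ge0.
move=> /psumr_eq0P => /(_ (fun y _ => sqr_ge0 _) x isT)/eqP.
by rewrite sqrf_eq0 => /eqP.
Qed.

Lemma cayley_stationary_dist : stationary_dist P = (fun=> N^-1).
Proof.
apply: xget_unique.
  split=> [x||y]; first by rewrite invr_ge0 ltW.
    by rewrite sum_const_fin mulfV ?gt_eqF.
  under eq_bigr do rewrite mulrC.
  rewrite (cayley_sum_sub S y (fun=> N^-1)) sum_const_set.
  by rewrite mulKf ?gt_eqF ?ltr0n.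
move=> pi [pi0 pi1 piP]; apply/funext => y.
pose v x := pi x - N^-1.
have v0 : \sum_x v x = 0 by rewrite sumrB pi1 sum_const_fin mulfV ?gt_eqF// subrr.
suff : v y = 0 by move/eqP; rewrite subr_eq0 => /eqP.
apply: poincare_eq0 => //; rewrite sum_Gamma//.
(* Invariance of [v] under the left action of [P] makes its energy zero. *)
have vP z : \sum_x v x * P x z = v z.
  rewrite /v; under eq_bigr do rewrite mulrBl.
  rewrite sumrB piP; congr (_ - _); under eq_bigr do rewrite mulrC.
  rewrite (cayley_sum_sub S z (fun=> N^-1)) sum_const_set.
  by rewrite mulKf ?gt_eqF ?ltr0n.
under eq_bigr do rewrite (markov_generatorE Pst) mulrBr mulr_sumr.
rewrite sumrB exchange_big/= oppr_le0 subr_ge0; apply: ler_sum => z _.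
by rewrite -{1}(vP z) mulr_suml; apply: ler_sum => x _; rewrite mulrA.
Qed.

(** The indicator of the generated subgroup is unchanged by every generator, so after centring it
    has zero energy and vanishes; the indicator is constant. *)
Lemma poincare_generates : generates S.
Proof.
apply/eqP; rewrite finset.eqEsubset finset.subsetT/=; apply/fintype.subsetP => z _.
pose f (x : G) : R := (x \in <<S>>%g)%:R.
pose a := N^-1 * \sum_x f x.
have fS x s : s \in S -> f (x + s) = f x.
  by move=> sS; rewrite /f -[x + s]/(x * s)%g groupMr// mem_gen.
have v0 x : f x - a = 0.
  apply: (@poincare_eq0 (fun x => f x - a)).
    by rewrite sumrB sum_const_fin /a mulVKf ?gt_eqF// subrr.
  rewrite big1// => y _; rewrite cayley_GammaE big1 ?mulr0// => s sS.
  by rewrite fS// subrr mul0r.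
have e0 : (0 : G) \in <<S>>%g := group1 [group of <<S>>%g].
have := v0 0; have := v0 z; rewrite /f e0.
case: (z \in _) => //= h0 h1; have /eqP : (1 : R) = 0 by lra.
by rewrite oner_eq0.
Qed.

Lemma kpow_sum_gt0 n (c : 'I_n -> G) y : (forall i, c i \in S) ->
  0 < kpow P n y (y + \sum_i c i).
Proof.
elim: n c y => [|n IH] c y cS /=; first by rewrite big_ord0 addr0 eqxx.
rewrite (cayley_sum S y) mulr_gt0 ?invr_gt0 ?ltr0n//.
rewrite (bigD1 (c ord0))//= ltr_pwDl//.
  by rewrite big_ord_recl addrA IH// => i; exact: cS.
by apply: sumr_ge0 => s _; exact: kpow_ge0.
Qed.

(** In a finite group the generated subgroup consists of products of generators without inverses, so
    directed paths suffice. *)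
Lemma cayley_irreducible : (1 < #|G|)%N -> irreducible_chain P.
Proof.
move=> G1; split=> // x y.
have : y - x \in <<S>>%g by rewrite poincare_generates inE.
move=> /gen_prodgP[n [c cS yx]]; exists n.
have := kpow_sum_gt0 x cS.
by rewrite -[X in x + X]/(\prod_i c i)%g -yx addrC subrK.
Qed.

Lemma cayley_variance_le (f : G -> R) :
  lambda * fin_variance (stationary_dist P) f <= dirichlet P f.
Proof.
have mean F : fin_mean (fun=> N^-1) F = (\sum_x F x) / N.
  by rewrite /fin_mean -mulr_suml.
rewrite /dirichlet cayley_stationary_dist /fin_variance !mean -mulr_suml.
rewrite mulrA ler_wpM2r ?invr_ge0 ?(ltW N_gt0)//.
set a := (\sum_x f x) / N.
have <- : \sum_x Gamma P (fun x => f x - a) (fun x => f x - a) x = \sum_x Gamma P f f x.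
  apply: eq_bigr => x _; rewrite !cayley_GammaE; congr (_ * (_ * _)).
  by apply: eq_bigr => s _; ring.
by apply: gap; rewrite sumrB sum_const_fin /a mulrCA mulfV ?gt_eqF// mulr1 subrr.
Qed.

Lemma cayley_trel_le : (trel P <= (lambda^-1)%:E)%E.
Proof.
apply: ge_ereal_sup => _ [f f0 <-]; rewrite lee_fin ler_pdivrMr//.
by rewrite -ler_pdivrMl ?invr_gt0// invrK cayley_variance_le.
Qed.

(** Excludes the value -oo of a supremum over the empty set: the indicator of 0 is not constant, so
    its energy is positive. *)
Lemma cayley_trel_ge0 : (1 < #|G|)%N -> (0 <= trel P)%E.
Proof.
move=> G1; pose f (x : G) : R := (x == 0)%:R.
have [f0|] := ltP 0 (dirichlet P f); last first.
  move=> hle; have [z z0] : exists z : G, z != 0.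
    apply/existsP; apply: contraTT G1 => /existsPn h; rewrite -leqNgt.
    have e (x : G) : x = 0 by have := h x; rewrite negbK => /eqP.
    by apply/card_le1_eqP => x y _ _; rewrite (e x) (e y).
  pose a := N^-1.
  have v0 x : f x - a = 0.
    apply: (@poincare_eq0 (fun x => f x - a)).
      rewrite sumrB sum_const_fin /a mulfV ?gt_eqF// (bigD1 0)//= /f eqxx big1 ?addr0 ?subrr//.
      by move=> y /negbTE ->.
    move: hle; rewrite /dirichlet cayley_stationary_dist -mulr_suml pmulr_lle0 ?invr_gt0//.
    apply: le_trans; apply: ler_sum => x' _; rewrite !cayley_GammaE; apply: ler_wpM2l => //.
    by apply: ler_wpM2l; rewrite ?invr_ge0//; apply: ler_sum => s _; rewrite le_eqVlt; apply/orP; left; apply/eqP; ring.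
  have := v0 0; have := v0 z; rewrite /f eqxx (negbTE z0) => /subr0_eq <-.
  by rewrite subr0 => /eqP; rewrite oner_eq0.
apply: le_trans (ereal_sup_ubound _); last by exists f.
rewrite lee_fin divr_ge0 ?(ltW f0)// /fin_variance /fin_mean.
apply: sumr_ge0 => x _; rewrite mulr_ge0 ?sqr_ge0//.
by rewrite cayley_stationary_dist invr_ge0 ltW.
Qed.

Lemma cayley_tmixE (eps : R) : tmix P eps =
  ereal_inf [set t%:E | t in [set t : R | 0 <= t /\ unif_tv S t <= eps]]%classic.
Proof.
rewrite /tmix cayley_stationary_dist; congr ereal_inf; congr image.
apply/seteqP; split=> t /= [t0 ht]; split => //.
  apply: le_trans ht; rewrite -(tv_heat_unif S t 0).
  exact: (le_bigmax_cond _ (fun x => tv_dist (heat_kernel P t x) (fun=> N^-1))).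
apply: bigmax_le => [|x _]; last by rewrite tv_heat_unif.
by apply: le_trans ht; rewrite mulr_ge0// sumr_ge0.
Qed.

End poincare_consequences.

(** * Directed distances in the Cayley graph *)

Lemma hit_distP (R : realType) (X : finType) (P : X -> X -> R) x y k :
  0 < kpow P k x y -> (forall j, 0 < kpow P j x y -> (k <= j)%N) ->
  hit_dist P x y = k.
Proof.
move=> hk hmin; rewrite /hit_dist; case: pselect => [h|[]]; last by exists k.
by case: ex_minnP => j hj jmin; apply/eqP; rewrite eqn_leq jmin// hmin.
Qed.

Lemma hit_dist_le (R : realType) (X : finType) (P : X -> X -> R) x y k :
  0 < kpow P k x y -> (hit_dist P x y <= k)%N.
Proof.
move=> hk; rewrite /hit_dist; case: pselect => [h|//].
by case: ex_minnP => j hj; apply.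
Qed.

Lemma hit_dist_gt0 (R : realType) (X : finType) (P : X -> X -> R) x y :
  (0 < hit_dist P x y)%N -> 0 < kpow P (hit_dist P x y) x y.
Proof.
by rewrite /hit_dist; case: pselect => [h|//] _; case: ex_minnP.
Qed.

Section cayley_local_geometry.
Variables (R : realType) (G : finZmodType) (S : {set G}).
Hypotheses (S_neq0 : (0 < #|S|)%N) (S0 : 0 \notin S).
Let P := @cayley_kernel R G S.
Let Pst : stochastic P. Proof. exact: cayley_stochastic. Qed.

Let cayley_gt0 x y : (0 < P x y) = (y - x \in S).
Proof.
by rewrite /P /cayley_kernel; case: ifP; rewrite ?ltxx// invr_gt0 ltr0n S_neq0.
Qed.

Let kpow1 x y : kpow P 1 x y = P x y.
Proof.
rewrite /= (bigD1 y)//= eqxx mulr1 big1 ?addr0// => z /negbTE ->.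
by rewrite mulr0.
Qed.

Lemma cayley_Delta : Delta P = #|S|%:R.
Proof.
apply/eqP; rewrite eq_le; apply/andP; split.
  apply: bigmax_le => // [[x y]] /= /andP[]; rewrite cayley_gt0 => xy _.
  by rewrite /P /cayley_kernel xy invrK.
have /card_gt0P[s sS] := S_neq0.
have PE : P 0 s = #|S|%:R^-1 by rewrite /P /cayley_kernel subr0 sS.
rewrite -[leLHS]invrK -PE.
apply: (le_bigmax_cond _ (fun xy : G * G => (P xy.1 xy.2)^-1) (j := (0, s))).
rewrite /= cayley_gt0 subr0 sS/=.
by apply: contraNneq S0 => ->.
Qed.

(** A jump by s is undone by two more jumps by s, since 3 s = 0; one jump suffices only if -s is in
    S, which fails for some s when S differs from -S. *)
Lemma cayley_kmax : (forall s : G, s *+ 3 = 0) -> S <> opp_set S -> kmax P = 2%N.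
Proof.
move=> G3 SN; apply/eqP; rewrite eqn_leq; apply/andP; split.
  apply/bigmax_leqP => -[x y]/= /eqP h1.
  have := @hit_dist_gt0 _ _ P x y; rewrite h1 => /(_ isT).
  rewrite kpow1 cayley_gt0 => xyS; apply: hit_dist_le.
  have /= := @kpow_sum_gt0 R G S S_neq0 2 (fun=> y - x) y (fun=> xyS).
  suff -> : y + \sum_(i < 2) (y - x) = x by [].
  rewrite sumr_const card_ord -[X in X + _](subrK x y) addrAC -mulrS G3.
  by rewrite add0r.
(* If -S were contained in S, equal cardinalities would force equality. *)
have [s sS sN] : exists2 s, s \in S & - s \notin S.
  apply/exists_inP; rewrite -negb_forall_in; apply/negP => /forall_inP h; apply: SN.
  apply/esym/eqP; rewrite eqEcard; apply/andP; split.
    by apply/fintype.subsetP => _ /imsetP[s sS ->]; exact: h.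
  by rewrite card_imset//; exact: oppr_inj.
have s0 : s != 0 by apply: contraNneq S0 => <-.
have h0s : hit_dist P 0 s = 1%N.
  apply: hit_distP; first by rewrite kpow1 cayley_gt0 subr0.
  by case=> //=; rewrite eq_sym (negbTE s0) ltxx.
have hs0 : hit_dist P s 0 = 2%N.
  apply: hit_distP.
    have /= := @kpow_sum_gt0 R G S S_neq0 2 (fun=> s) s (fun=> sS).
    by rewrite sumr_const card_ord -mulrS G3.
  case=> [|[|//]]; first by rewrite /= (negbTE s0) ltxx.
  by rewrite kpow1 cayley_gt0 sub0r (negbTE sN).
rewrite -{1}hs0.
by apply: (@leq_bigmax_cond _ _ (fun xy : G * G => hit_dist P xy.2 xy.1) (0, s)); rewrite /= h0s.
Qed.

End cayley_local_geometry.

Lemma Z3pow_mulrn3 d (s : Z3pow d) : s *+ 3 = 0.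
Proof. by apply/rowP => i; rewrite mulmxnE mxE; case: (Z3_cases (s 0 i)) => ->; apply: val_inj. Qed.

Lemma card_Z3pow d : #|Z3pow d| = (3 ^ d)%N.
Proof. by rewrite card_mx card_ord mul1n. Qed.

Lemma spectral_bound_good (R : realType) d (S : {set Z3pow d}) (rho : R) :
  (0 < d)%N -> (0 < #|S|)%N -> rho < 1 -> 0 \notin S -> S <> opp_set S ->
  spectral_bound S rho -> nonreversible_walk_bounds S #|S| rho.
Proof.
move=> d0 S0 rho1 S0N SN /(spectral_bound_poincare S0) gap.
have l0 : 0 < 1 - rho by rewrite subr_gt0.
split=> //.
- exact: poincare_generates gap.
- by apply: (cayley_irreducible S0 l0 gap); rewrite card_Z3pow -(expn0 3) ltn_exp2l.
split.
- by apply: cayley_kmax => //; exact: Z3pow_mulrn3.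
- exact: cayley_Delta.
- by rewrite div1r; exact: cayley_trel_le.
- exact: bakry_emery_ge0.
Qed.

(** * Counting exceptional generating sets *)
Section exponential_bounds.
Variable R : realType.

Lemma expR_le1D2x (x : R) : 0 <= x <= 1 -> expR x <= 1 + 2 * x.
Proof.
move=> /andP[x0 x1].
(* From exp(x / 6) <= 1 / (1 - x / 6). In the sixth power of 1 + x / 5, the coefficients of the
   positive powers of x sum to slightly less than 2. *)
have h1 : expR (x / 6) <= 1 + x / 5.
  have := expR_ge1Dx (- (x / 6)); rewrite expRN => h.
  have e0 := expR_gt0 (x / 6).
  have : (1 + - (x / 6)) * expR (x / 6) <= 1.
    by rewrite -ler_pdivlMr// div1r.
  nra.
have -> : expR x = expR (x / 6) ^+ 6 by rewrite -expRM_natl; congr expR; field.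
apply: (@le_trans _ _ ((1 + x / 5) ^+ 6)).
  by rewrite lerXn2r// nnegrE ?expR_ge0//; lra.
have hx k : x ^+ k.+1 <= x by rewrite exprS ler_piMr// exprn_ile1.
have -> : (1 + x / 5) ^+ 6 = 1 + 6 / 5 * x + 3 / 5 * x ^+ 2 + 4 / 25 * x ^+ 3
    + 3 / 125 * x ^+ 4 + 6 / 3125 * x ^+ 5 + 1 / 15625 * x ^+ 6 by field.
have := hx 1; have := hx 2; have := hx 3; have := hx 4; have := hx 5.
lra.
Qed.

Lemma expR_le1DxDx2 (x : R) : 0 <= x <= 1 -> expR x <= 1 + x + x ^+ 2.
Proof.
move=> /andP[x0 x1].
pose f (t : R) := expR t - t - t ^+ 2.
have hf (t : R) : is_derive t 1 f (expR t - 1 - 2 * t).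
  have h := is_deriveB (is_deriveB (is_derive_expR t) (is_derive_id t 1))
    (is_deriveX 2 (is_derive_id t 1)).
  by apply: is_derive_eq h _; rewrite /GRing.scale/= expr1 mulr1.
have h : f x - f 0 <= 0 * (x - 0).
  apply: is_derive_le x0 hf _ => t /andP[t0 tx].
  have : expR t <= 1 + 2 * t by apply: expR_le1D2x; rewrite t0 (le_trans tx x1).
  lra.
by move: h; rewrite /f expR0 expr0n/=; lra.
Qed.

Lemma expRN_le1BxDx2 (x : R) : 0 <= x -> expR (- x) <= 1 - x + x ^+ 2.
Proof.
move=> x0; rewrite expRN -div1r ler_pdivrMr ?expR_gt0//.
apply: (@le_trans _ _ ((1 - x + x ^+ 2) * (1 + x))).
  have := exprn_ge0 3 x0; lra.
rewrite ler_wpM2l ?expR_ge1Dx//.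
have := sqr_ge0 (x - 2^-1); lra.
Qed.

(* Hoeffding's lemma for the law [1/3 delta_1 + 2/3 delta_(-1/2)]. *)
Lemma hoeffding_cos3 (x : R) : 0 <= x <= 1 ->
  3^-1 * expR x + 2 / 3 * expR (- (x / 2)) <= expR (x ^+ 2 / 2).
Proof.
move=> hx; have /andP[x0 x1] := hx.
(* In the average of these quadratic bounds the linear terms cancel and the quadratic ones add up to
   exactly x^2 / 2. *)
have h1 := expR_le1DxDx2 hx.
have h2 : expR (- (x / 2)) <= 1 - x / 2 + (x / 2) ^+ 2.
  by apply: expRN_le1BxDx2; lra.
have h3 := expR_ge1Dx (x ^+ 2 / 2).
lra.
Qed.

End exponential_bounds.

(** * Counting subsets of prescribed size *)

Section subset_counting.
Variable X : finType.
Implicit Types U J K A : {set X}.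

Definition draws U m : {set {set X}} := [set A : {set X} | (A \subset U) && (#|A| == m)]%SET.

Lemma card_draws_sup U J m : J \subset U -> (#|J| <= m)%N ->
  #|[set A in draws U m | J \subset A]%SET| = 'C(#|U| - #|J|, m - #|J|).
Proof.
move=> JU Jm.
rewrite -(_ : #|U :\: J| = (#|U| - #|J|)%N); last first.
  by rewrite cardsD (finset.setIidPr JU).
rewrite -cards_draws.
rewrite -(@card_in_imset _ _ (fun B => B :|: J) [set B : {set X} | B \subset U :\: J & #|B| == (m - #|J|)%N]%SET); last first.
  move=> B1 B2; rewrite !inE !finset.subsetD => /andP[/andP[_ d1] _] /andP[/andP[_ d2] _] e.
  have key (B : {set X}) : [disjoint B & J] -> (B :|: J) :\: J = B.
    by move=> dB; rewrite finset.setDUl finset.setDv finset.setU0; apply/finset.setDidPl.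
  by rewrite -(key _ d1) -(key _ d2) e.
congr (#|pred_of_set _|); apply/setP => A; apply/idP/imsetP.
  rewrite !inE => /andP[/andP[AU /eqP Am] JA].
  exists (A :\: J).
    rewrite inE finset.setSD//= cardsD (finset.setIidPr JA) Am eqxx//.
  by rewrite -[LHS](finset.setID A J) (finset.setIidPr JA) finset.setUC.
move=> [B]; rewrite inE finset.subsetD => /andP[/andP[BU dB] /eqP Bm ->].
rewrite !inE finset.subUset BU JU finset.subsetUr andbT/= cardsU.
by move: dB; rewrite -setI_eq0 => /eqP ->; rewrite cards0 Bm subn0 subnK.
Qed.

Lemma card_draws_in U m : #|draws U m| = 'C(#|U|, m).
Proof. by rewrite -cards_draws. Qed.

(** Counts the pairs of a draw A and a j-subset of A inside K in both orders: the binomial moments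
    of the hypergeometric law. *)
Lemma sum_draws_bin U K m j : K \subset U -> (j <= m)%N ->
  (\sum_(A in draws U m) 'C(#|A :&: K|, j) = 'C(#|K|, j) * 'C(#|U| - j, m - j))%N.
Proof.
move=> KU jm.
transitivity (\sum_(A in draws U m) \sum_(J in draws K j) (J \subset A))%N.
  apply: eq_bigr => A _; rewrite -cards_draws -sum1_card.
  rewrite -big_mkcondr/=; apply: eq_bigl => J.
  by rewrite !inE finset.subsetI andbC -!andbA andbCA andbA andbC andbA; case: (J \subset A); rewrite ?andbT ?andbF// andbC.
rewrite exchange_big/= -card_draws_in -sum_nat_const; apply: eq_bigr => J.
rewrite inE => /andP[JK /eqP Jj].
rewrite -Jj -card_draws_sup ?Jj//; last exact: fintype.subset_trans KU.
by rewrite -big_mkcondr/= sum1_card; apply: eq_card => A; rewrite [RHS]inE.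
Qed.

End subset_counting.

Lemma mul_bin_bin N m j : (j <= m <= N)%N ->
  ('C(N, m) * 'C(m, j) = 'C(N, j) * 'C(N - j, m - j))%N.
Proof.
move=> /andP[jm mN].
have jN := leq_trans jm mN.
have p : (0 < j`! * (m - j)`! * (N - m)`!)%N by rewrite !muln_gt0 !fact_gt0.
apply/eqP; rewrite -(eqn_pmul2r p); apply/eqP.
have e1 := bin_fact mN; have e2 := bin_fact jm; have e3 := bin_fact jN.
have e4 : ('C(N - j, m - j) * ((m - j)`! * (N - m)`!) = (N - j)`!)%N.
  by rewrite -(bin_fact (leq_sub2r j mN)) subnBA// subnK.
transitivity (N`!); first by rewrite -e1 -e2; ring.
by rewrite -e3 -e4; ring.
Qed.

(** Factor by factor, (k - i) / (N - i) <= k / N. *)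
Lemma ffact_ratio k N j : (k <= N)%N -> (k ^_ j * N ^ j <= N ^_ j * k ^ j)%N.
Proof.
move=> kN; elim: j => [|j IH]; first by [].
rewrite !ffactnSr !expnS.
have h : ((k - j) * N <= (N - j) * k)%N by rewrite !mulnBl mulnC leq_sub2l// leq_mul2l kN orbT.
have := leq_mul IH h.
by rewrite (_ : k ^_ j * N ^ j * ((k - j) * N) = k ^_ j * (k - j) * (N * N ^ j))%N;
  [rewrite (_ : N ^_ j * k ^ j * ((N - j) * k) = N ^_ j * (N - j) * (k * k ^ j))%N; last ring|ring].
Qed.

Lemma bin_ratio k N j : (k <= N)%N -> ('C(k, j) * N ^ j <= 'C(N, j) * k ^ j)%N.
Proof.
move=> kN; rewrite -(leq_pmul2r (fact_gt0 j)) mulnAC bin_ffact.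
by rewrite [leqRHS]mulnAC bin_ffact ffact_ratio.
Qed.

(* Sampling without replacement is dominated by sampling with replacement:
   both sides are expanded in powers of [u]. *)
Lemma draws_mgf (R : realType) (X : finType) (U K : {set X}) m (u : R) :
  K \subset U -> (0 < m <= #|U|)%N -> 0 <= u ->
  \sum_(A in draws U m) (1 + u) ^+ #|A :&: K| <=
    'C(#|U|, m)%:R * (1 + u * (#|K|%:R / #|U|%:R)) ^+ m.
Proof.
move=> KU /andP[m0 mU] u0.
have U0 : (0 : R) < #|U|%:R by rewrite ltr0n (leq_trans m0).
have expand (x : R) n : (n <= m)%N -> (1 + x) ^+ n = \sum_(j < m.+1) 'C(n, j)%:R * x ^+ j.
  move=> nm; rewrite exprDn (big_ord_widen m.+1 (fun j : nat => 1 ^+ (n - j) * x ^+ j *+ 'C(n, j))) ?ltnS//.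
  rewrite big_mkcond/=; apply: eq_bigr => j _.
  case: ifP => [_|]; first by rewrite expr1n mul1r mulr_natl.
  by rewrite ltnS => /negbT; rewrite -ltnNge => nj; rewrite bin_small// mul0r.
have -> : \sum_(A in draws U m) (1 + u) ^+ #|A :&: K| =
    \sum_(j < m.+1) ('C(#|K|, j) * 'C(#|U| - j, m - j))%:R * u ^+ j.
  transitivity (\sum_(A in draws U m) \sum_(j < m.+1) 'C(#|A :&: K|, j)%:R * u ^+ j).
    apply: eq_bigr => A; rewrite inE => /andP[_ /eqP Am].
    by rewrite expand// -Am subset_leq_card// finset.subsetIl.
  rewrite exchange_big/=; apply: eq_bigr => j _.
  by rewrite -mulr_suml -natr_sum sum_draws_bin// -ltnS.
rewrite expand// mulr_sumr; apply: ler_sum => j _.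
have -> : 'C(#|U|, m)%:R * ('C(m, j)%:R * (u * (#|K|%:R / #|U|%:R)) ^+ j) =
    'C(#|U|, m)%:R * 'C(m, j)%:R * #|K|%:R ^+ j / #|U|%:R ^+ j * u ^+ j :> R.
  by rewrite !exprMn exprVn; ring.
rewrite ler_wpM2r ?exprn_ge0// ler_pdivlMr ?exprn_gt0//.
rewrite -!natrX -!natrM ler_nat.
have jm : (j <= m)%N by rewrite -ltnS.
rewrite mul_bin_bin ?jm// -mulnA [('C(_ - _, _) * _)%N]mulnC mulnA [leqRHS]mulnAC.
by rewrite leq_mul// bin_ratio// subset_leq_card.
Qed.

Lemma nonzero_subsetsE (G : finZmodType) m :
  nonzero_subsets G m = draws (~: [set (0 : G)])%SET m.
Proof. by apply/setP => A; rewrite !inE finset.subsetC finset.sub1set inE. Qed.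

Lemma card_nonzero (G : finZmodType) : #|(~: [set (0 : G)])%SET| = #|G|.-1.
Proof. by rewrite cardsC1. Qed.

(** Counts the pairs of a symmetric A and s in A. As s and -s differ, a symmetric set containing s
    contains a given pair, which leaves at most 'C(|G| - 3, m - 2) choices. *)
Lemma card_symmetric_subsets (G : finZmodType) m :
  (forall s : G, s + s = 0 -> s = 0) -> (0 < m < #|G|)%N ->
  (#|[set A in nonzero_subsets G m | A == opp_set A]%SET| * #|G|.-2 <=
   m.-1 * 'C(#|G|.-1, m))%N.
Proof.
move=> G2 /andP[m0 mG].
set B := finset _; set U := (~: [set (0 : G)])%SET.
have cU : #|U| = #|G|.-1 by exact: card_nonzero.
have sym A s : A \in B -> s \in A -> - s \in A.
  rewrite inE => /andP[_ /eqP eA]; rewrite {1}eA => /imsetP[r rA ->].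
  by rewrite opprK.
have dc : (#|B| * m <= #|G|.-1 * 'C(#|G|.-1 - 2, m - 2))%N.
  have -> : (#|B| * m = \sum_(A in B) \sum_(s in U) (s \in A))%N.
    rewrite -sum_nat_const; apply: eq_bigr => A; rewrite inE => /andP[+ _].
    rewrite nonzero_subsetsE inE => /andP[/fintype.subsetP AU /eqP <-].
    rewrite -big_mkcondr/= -sum1_card; apply: eq_bigl => s.
    by case: (boolP (s \in A)) => [/AU ->|_]; rewrite ?andbF.
  rewrite exchange_big/= -cU -sum_nat_const; apply: leq_sum => s.
  rewrite !inE => s0; rewrite -big_mkcondr/= sum1_card.
  have sNs : s != - s.
    by apply: contraNneq s0 => e; apply/eqP/G2; rewrite {2}e subrr.
  have c2 : #|[set s; - s]%SET| = 2%N by rewrite cards2 sNs.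
  have [m1|m1] := ltnP m 2.
    rewrite eq_card0// => A; apply/negP => /andP[AB sA].
    have := sym _ _ AB sA; move: AB; rewrite !inE => /andP[/andP[_ /eqP Am] _] NsA.
    have : ([set s; - s] \subset A)%SET by rewrite finset.subUset !finset.sub1set sA NsA.
    by move/subset_leq_card; rewrite c2 Am leqNgt m1.
  rewrite -c2 -card_draws_sup ?c2//; last first.
    by rewrite finset.subUset !finset.sub1set !inE oppr_eq0 s0.
  apply: subset_leq_card; apply/fintype.subsetP => A; rewrite inE => /andP[AB sA].
  have AD : A \in draws U m by move: AB; rewrite inE nonzero_subsetsE => /andP[].
  move: AD; rewrite !inE => ->; rewrite finset.subUset !finset.sub1set sA/=.
  exact: sym AB sA.
(* [mul_bin_bin] with j = 2 needs 2 <= m; for m = 1, a singleton of a nonzero element is never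
   symmetric. *)
have [m1|m1] := ltnP m 2.
  have m1' : m = 1%N by apply/eqP; rewrite eqn_leq -ltnS m1 m0.
  have : #|B| = 0%N.
    apply: eq_card0 => A; apply/negP => AB.
    have := AB; rewrite !inE => /andP[/andP[A0 /eqP Am] _].
    have /card_gt0P[s sA] : (0 < #|A|)%N by rewrite Am.
    have NsA := sym _ _ AB sA.
    have sNs : s != - s.
      apply: contraNneq A0 => e; suff <- : s = 0 by [].
      by apply: G2; rewrite {2}e subrr.
    have : ([set s; - s] \subset A)%SET by rewrite finset.subUset !finset.sub1set sA NsA.
    by move/subset_leq_card; rewrite cards2 sNs Am m1'.
  by move=> ->.
have mG1 : (m <= #|G|.-1)%N by lia.
have e : ('C(#|G|.-1, m) * 'C(m, 2) = 'C(#|G|.-1, 2) * 'C(#|G|.-1 - 2, m - 2))%N.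
  by apply: mul_bin_bin; rewrite m1.
have b1 := mul_bin_diag m 1; rewrite bin1 in b1.
have b2 := mul_bin_diag #|G|.-1 1; rewrite bin1 in b2.
have G0 : (0 < #|G|.-1)%N by lia.
rewrite -(leq_pmul2l m0) -(leq_pmul2l G0).
move: dc e b1 b2; set b := #|B|; set g := #|G|.-1; set C1 := 'C(g, m).
set C2 := 'C(g - 2, _); set C3 := 'C(g, 2); set C4 := 'C(m, 2).
move=> dc e b1 b2.
have h := leq_mul dc (leqnn (g * g.-1)%N).
have -> : (g * (m * (b * g.-1)) = b * m * (g * g.-1))%N by ring.
apply: leq_trans h _.
rewrite (_ : g * C2 * (g * g.-1) = g * (m * (m.-1 * C1)))%N//.
transitivity (g * (2 * (C3 * C2)))%N; first by rewrite b2; ring.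
by rewrite -e; transitivity (g * (2 * C4 * C1))%N; [ring|rewrite -b1; ring].
Qed.

Section bad_sets.
Variables (R : realType) (d m : nat) (rho : R).
Hypotheses (rho0 : 0 <= rho <= 1) (m_bounds : (0 < m < 3 ^ d)%N).
Local Notation G := (Z3pow d).
Let C : R := 'C(#|G|.-1, m)%:R.

(** Chernoff bound with tilt rho, the minimiser of l^2 / 2 - l rho, an exponent supplied by
    [hoeffding_cos3]. The character sum over A depends only on the number of points of A in the
    kernel K of the character. *)
Lemma card_bad_character (a : G) : a != 0 ->
  #|[set A in nonzero_subsets G m |
      rho * m%:R < \sum_(s in A) cos3 R (dotp a s)]%SET|%:R <=
  C * expR (- (m%:R * rho ^+ 2 / 2)).
Proof.
move=> a0; have /andP[m0 m3] := m_bounds; have /andP[r0 r1] := rho0.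
set U := (~: [set (0 : G)])%SET.
have cG : #|G| = (3 ^ d)%N := card_Z3pow d.
have cU : #|U| = (3 ^ d).-1 by rewrite /U card_nonzero cG.
have U0 : (0 < #|U|)%N by rewrite cU; lia.
pose K := [set x in U | dotp a x == 0]%SET.
have KU : K \subset U by apply/fintype.subsetP => x; rewrite inE => /andP[].
(* Orthogonality gives 3 |K| + 3 = 3^d, as 0 is left out of K. *)
have cK : (3 * #|K| <= #|U|)%N.
  have h := sum_cos3_dotp R a; rewrite (negbTE a0) mul0r in h.
  have hC (x : G) : cos3 R (dotp x a) = (3 / 2) * (dotp a x == 0)%:R - 2^-1.
    by rewrite dotpC /cos3; case: eqP => _ /=; lra.
  move: h; under eq_bigr do rewrite hC.
  rewrite sumrB -mulr_sumr sum_const_fin (bigD1 0)//= dotp0r eqxx cG.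
  have -> : \sum_(x | x != 0) (dotp a x == 0)%:R = #|K|%:R :> R.
    rewrite -sum1_card natr_sum [RHS](eq_bigl (fun x => (x != 0) && (dotp a x == 0))).
      by rewrite big_mkcondr/=; apply: eq_bigr => x _; case: eqP.
    by move=> x; rewrite !inE.
  move=> h; have : (3 * #|K| + 3)%N%:R = (3 ^ d)%:R :> R.
    by move: h; rewrite natrD natrM /=; set q := (3 ^ d)%:R; set k := #|K|%:R; lra.
  by move/eqP; rewrite eqr_nat => /eqP e; rewrite cU -e addn3; do 2 apply: leqW.
have cosK (A : {set G}) : A \subset U -> \sum_(s in A) cos3 R (dotp a s) =
    3 / 2 * #|A :&: K|%:R - 2^-1 * #|A|%:R.
  move=> /fintype.subsetP AU.
  have -> : #|A :&: K|%:R = \sum_(s in A) (dotp a s == 0)%:R :> R.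
    rewrite -sum1_card natr_sum [LHS](eq_bigl (fun s => (s \in A) && (dotp a s == 0))).
      by rewrite big_mkcondr/=; apply: eq_bigr => x _; case: eqP.
    move=> s; rewrite inE [in RHS]/=; case: (boolP (s \in A)) => //= sA.
    by rewrite inE AU.
  rewrite -sum1_card natr_sum !mulr_sumr -sumrB; apply: eq_bigr => s _.
  by rewrite /cos3; case: eqP => _ /=; lra.
(* Each point of A in K raises the cosine sum by 3 / 2, hence the tilted weight by the factor 1 +
   u. *)
pose u := expR (3 / 2 * rho) - 1.
have u0 : 0 <= u by have := expR_ge1Dx (3 / 2 * rho); rewrite /u; lra.
have markov : #|[set A in nonzero_subsets G m |
      rho * m%:R < \sum_(s in A) cos3 R (dotp a s)]%SET|%:R <=
    expR (- (m%:R * rho / 2) - m%:R * rho ^+ 2) *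
    \sum_(A in draws U m) (1 + u) ^+ #|A :&: K|.
  rewrite -sum1_card natr_sum mulr_sumr -nonzero_subsetsE.
  rewrite [leRHS](bigID (fun A : {set G} => rho * m%:R < \sum_(s in A) cos3 R (dotp a s)))/=.
  rewrite -[leLHS]addr0; apply: lerD; last first.
    by apply: sumr_ge0 => A _; rewrite mulr_ge0 ?expR_ge0// exprn_ge0// addr_ge0.
  rewrite (eq_bigl (fun A => (A \in nonzero_subsets G m) &&
    (rho * m%:R < \sum_(s in A) cos3 R (dotp a s)))); last by move=> A; rewrite inE.
  apply: ler_sum => A /andP[]; rewrite nonzero_subsetsE inE => /andP[AU /eqP Am].
  rewrite cosK// Am (_ : 1 + u = expR (3 / 2 * rho)); last by rewrite /u addrC subrK.
  rewrite -expRM_natl -expRD => hA.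
  apply: le_trans (expR_ge1Dx _); nra.
apply: le_trans markov _.
have mU : (0 < m <= #|U|)%N by rewrite m0 cU; lia.
apply: (@le_trans _ _ (expR (- (m%:R * rho / 2) - m%:R * rho ^+ 2) *
    (C * (1 + u / 3) ^+ m))).
  rewrite ler_wpM2l ?expR_ge0//.
  apply: le_trans (draws_mgf KU mU u0) _.
  rewrite -/U cU /C cG ler_wpM2l// lerXn2r ?nnegrE ?addr_ge0 ?mulr_ge0 ?invr_ge0//.
  rewrite lerD2l ler_wpM2l// ler_pdivrMr ?ltr0n -?cU//.
  by rewrite ler_pdivlMl// -natrM ler_nat -?cU.
rewrite mulrCA ler_wpM2l//.
have -> : expR (- (m%:R * rho / 2) - m%:R * rho ^+ 2) =
    (expR (- (rho / 2)) * expR (- rho ^+ 2)) ^+ m.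
  by rewrite -expRD -expRM_natl; congr expR; ring.
have -> : expR (- (m%:R * rho ^+ 2 / 2)) = (expR (rho ^+ 2 / 2) * expR (- rho ^+ 2)) ^+ m.
  by rewrite -expRD -expRM_natl; congr expR; field.
have u3 : 0 <= 1 + u / 3 by rewrite addr_ge0// divr_ge0.
rewrite -exprMn lerXn2r ?nnegrE ?mulr_ge0 ?expR_ge0//.
rewrite mulrAC ler_wpM2r ?expR_ge0//.
apply: le_trans (hoeffding_cos3 rho0).
rewrite le_eqVlt; apply/orP; left; apply/eqP.
have -> : expR rho = expR (- (rho / 2)) * expR (3 / 2 * rho).
  by rewrite -expRD; congr expR; field.
by rewrite /u; field.
Qed.

(** A boolean, so that failing sets can be counted; m stands for the cardinality of A. *)
Definition well_spread (A : {set G}) : bool :=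
  [forall a, (a != 0) ==> (\sum_(s in A) cos3 R (dotp a s) <= rho * m%:R)] &&
  (A != opp_set A).

Lemma card_not_well_spread :
  #|[set A in nonzero_subsets G m | ~~ well_spread A]%SET|%:R <=
  C * ((3 ^ d)%:R * expR (- (m%:R * rho ^+ 2 / 2)) + m%:R * (3 : R) ^ (1 - d%:Z)).
Proof.
have /andP[m0 m3] := m_bounds.
have cG : #|G| = (3 ^ d)%N := card_Z3pow d.
pose bad a := [set A in nonzero_subsets G m |
      rho * m%:R < \sum_(s in A) cos3 R (dotp a s)]%SET.
pose sy := [set A in nonzero_subsets G m | A == opp_set A]%SET.
have sub : [set A in nonzero_subsets G m | ~~ well_spread A]%SET \subset
    (finset.cover [set bad a | a in [set~ (0 : G)]] :|: sy)%SET.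
  apply/fintype.subsetP => A; rewrite inE => /andP[An].
  rewrite /well_spread negb_and negbK => /orP[|Asy]; rewrite inE; last first.
    by apply/orP; right; rewrite inE An.
  move=> /forallPn[a]; rewrite negb_imply -ltNge => /andP[a0 Aa].
  apply/orP; left; apply/bigcupP; exists (bad a).
    by apply/imsetP; exists a => //; rewrite !inE.
  by rewrite inE An.
have d0 : (0 < d)%N by move: m3 m0; case: (d) => //; rewrite expn0; case: (m).
have hsy : #|sy|%:R <= C * (m%:R * (3 : R) ^ (1 - d%:Z)).
  have G2 (s : G) : s + s = 0 -> s = 0.
    by move=> h; have := Z3pow_mulrn3 s; rewrite mulrS mulr2n h addr0.
  have := card_symmetric_subsets G2; rewrite cG => /(_ m m_bounds).
  rewrite -/sy => h.
  have e3 : (3 : R) ^ (1 - d%:Z) = ((3 ^ d.-1)%:R)^-1.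
    rewrite -{1}(prednK d0) natrX exprnN; congr (_ ^ _); lia.
  rewrite e3 mulrA ler_pdivlMr ?ltr0n ?expn_gt0// -!natrM ler_nat.
  have p3 : (3 ^ d = 3 * 3 ^ d.-1)%N by rewrite -expnS prednK.
  have p0 : (0 < 3 ^ d.-1)%N by rewrite expn_gt0.
  (* Uses 3^(d - 1) <= 3^d - 2, valid for d >= 1. *)
  apply: (@leq_trans (#|sy| * (3 ^ d).-2)); first by rewrite leq_mul2l; apply/orP; right; lia.
  by apply: leq_trans h _; rewrite mulnC cG leq_mul2l leq_pred orbT.
have hbad : #|finset.cover [set bad a | a in [set~ (0 : G)]]%SET|%:R <=
    C * ((3 ^ d)%:R * expR (- (m%:R * rho ^+ 2 / 2))).
  rewrite finset.cover_imset.
  apply: (@le_trans _ _ (\sum_(a in [set~ (0 : G)]%SET) #|bad a|%:R)).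
    rewrite -natr_sum ler_nat.
    elim/big_ind2 : _ => [|A1 n1 A2 n2 h1 h2|//]; first by rewrite cards0.
    by apply: leq_trans (leq_card_setU _ _) _; exact: leq_add.
  apply: (@le_trans _ _ (\sum_(a in [set~ (0 : G)]%SET) C * expR (- (m%:R * rho ^+ 2 / 2)))).
    by apply: ler_sum => a; rewrite !inE => a0; exact: card_bad_character.
  rewrite sum_const_set mulrCA ler_wpM2l// ler_wpM2r ?expR_ge0// ler_nat -cG.
  exact: max_card.
rewrite mulrDr; apply: le_trans (lerD hbad hsy).
rewrite -natrD ler_nat; apply: leq_trans (subset_leq_card sub) _.
exact: leq_card_setU.
Qed.

End bad_sets.

(** * Mixing times and cutoff *)
Section mixing_window.
Variables (R : realType) (G : finZmodType) (S : {set G}) (lambda : R).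
Hypotheses (S_neq0 : (0 < #|S|)%N) (lambda0 : 0 < lambda).
Hypothesis gap : poincare S lambda.
Let P := @cayley_kernel R G S.
Let Pst : stochastic P. Proof. exact: cayley_stochastic. Qed.
Let N : R := #|G|%:R.
Let N_gt0 : 0 < N. Proof. by rewrite ltr0n; apply/card_gt0P; exists 0. Qed.

Definition mixing_times (eps : R) : set R := [set t | 0 <= t /\ unif_tv S t <= eps]%classic.

Lemma mixing_times_nonempty (eps : R) : 0 < eps -> (mixing_times eps !=set0)%classic.
Proof.
move=> e0.
pose v (x : G) : R := (x == 0)%:R - N^-1.
have v0 : \sum_x v x = 0.
  rewrite sumrB sum_const_fin mulfV ?gt_eqF// (bigD1 0)//= eqxx big1 ?addr0 ?subrr//.
  by move=> y /negbTE ->.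
pose K := Num.sqrt (N * \sum_x v x ^+ 2).
have K0 : 0 <= K by exact: sqrtr_ge0.
(* At this time the distance is at most K exp(- K / eps) / 2, which y exp(- y) <= 1 bounds by eps /
   2. *)
have t0 : 0 <= K / (eps * lambda) by rewrite divr_ge0// mulr_ge0// ltW.
exists (K / (eps * lambda)); split => //.
have : unif_tv S (K / (eps * lambda)) <= 2^-1 * (expR (- (K / eps)) * K).
  rewrite /unif_tv ler_wpM2l ?invr_ge0//.
  have -> : K / eps = lambda * (K / (eps * lambda)) by field; rewrite !gt_eqF.
  apply: le_trans (heat_op_norm_sum_le S_neq0 gap t0 v0).
  apply: ler_sum => x _; rewrite heat_op_sub heat_op_cst//.
  by rewrite heat_kernel_indicE.
move=> /le_trans; apply.
have k0 : 0 <= K / eps by rewrite divr_ge0// ltW.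
have h := expR_ge1Dx (K / eps).
have e1 := expR_gt0 (K / eps).
have h2 : expR (- (K / eps)) * (K / eps) <= 1.
  by rewrite expRN ler_pdivrMl// mulr1; lra.
have h3 : expR (- (K / eps)) * K <= eps.
  have -> : expR (- (K / eps)) * K = eps * (expR (- (K / eps)) * (K / eps)).
    by field; rewrite gt_eqF.
  by rewrite ger_pMr.
have : 0 <= expR (- (K / eps)) * K by rewrite mulr_ge0// expR_ge0.
lra.
Qed.

Let has_inf_mixing_times (eps : R) : 0 < eps -> has_inf (mixing_times eps).
Proof. by move=> e0; split; [exact: mixing_times_nonempty|exists 0 => t []]. Qed.

Lemma tmix_inf (eps : R) : 0 < eps -> tmix P eps = (inf (mixing_times eps))%:E.
Proof.
move=> /has_inf_mixing_times [h1 h2].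
by rewrite (cayley_tmixE S_neq0 lambda0 gap) ereal_inf_EFin.
Qed.

(** Three contributions to the window, in units of t1 q: the unit lost in approximating an infimum,
    the constant term of [unif_tv_window], and its square-root term. *)
Definition window_const (eps : R) : R :=
  1 + (ln (2 / eps) / 2 - ln eps) / lambda + 2 * Num.sqrt (2 / eps) / lambda.

(** The window has order C sqrt t1; since t1 >= L, the hypothesis C <= q sqrt L turns this into a
    fraction of order q of t1. *)
Lemma window_estimate (eps C L q : R) : 0 < eps < 1 / 2 -> 1 <= C -> 0 < q <= 1 ->
  C <= q * Num.sqrt L ->
  (forall t x, 1 <= t -> 0 < heat_kernel P t x 0) ->
  (forall t x s, 1 <= t -> s \in S ->
    `|ln (heat_kernel P t (x + s) 0) - ln (heat_kernel P t x 0)| <= C) ->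
  (forall t, 0 <= t -> unif_tv S t <= 1 - eps -> L <= t) ->
  exists t1 t2, [/\ tmix P (1 - eps) = t1%:E, tmix P eps = t2%:E, L <= t1,
    t1 <= t2 & t2 <= t1 * (1 + window_const eps * q)].
Proof.
move=> /andP[e0 e12] C1 /andP[q0 q1] CqL pos step lower.
have e'0 : 0 < 1 - eps by lra.
set t1 := inf (mixing_times (1 - eps)); set t2 := inf (mixing_times eps).
exists t1, t2.
have Lt1 : L <= t1.
  by apply: lb_le_inf => [|t [t0 tv]]; [exact: mixing_times_nonempty|exact: lower].
split => //; try exact: tmix_inf.
  apply: lb_le_inf => [|t [t0 tv]]; first exact: mixing_times_nonempty.
  apply: inf_lbound; first by case: (has_inf_mixing_times e'0).
  split => //; apply: le_trans tv _; lra.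
have sL1 : 1 <= Num.sqrt L by have := sqrtr_ge0 L; nra.
have L1 : 1 <= L.
  have L0 : 0 <= L by rewrite leNgt; apply/negP => /ltW/ler0_sqrtr h; move: sL1; rewrite h ler10.
  by rewrite -(sqr_sqrtr L0) -[leLHS](expr1n _ 2) lerXn2r ?nnegrE ?sqrtr_ge0.
have t11 : 1 <= t1 by exact: le_trans Lt1.
(* A time below t1 + 1 stands in for the infimum. *)
have [t [t0 tv] tt1] := inf_adherent ltr01 (has_inf_mixing_times e'0).
have t1' : 1 <= t by apply: le_trans L1 _; exact: lower.
rewrite -/t1 in tt1.
pose a := ln (2 / eps) / 2 - ln eps.
have a0 : 0 <= a.
  have : 0 <= ln (2 / eps) by rewrite ln_ge0// ler_pdivlMr//; lra.
  have : ln eps <= 0 by rewrite ln_le0//; lra.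
  rewrite /a; lra.
pose b := Num.sqrt (2 / eps).
have b0 : 0 <= b by exact: sqrtr_ge0.
pose u := (a + b * C * Num.sqrt (t1 + 1)) / lambda.
have C0 : 0 <= C by lra.
have u0 : 0 <= u.
  apply: divr_ge0; last exact: ltW.
  by apply: addr_ge0 => //; apply: mulr_ge0 (sqrtr_ge0 _); exact: mulr_ge0.
have mix : mixing_times eps (t + u).
  split; first by rewrite addr_ge0.
  apply: (@unif_tv_window _ _ _ S_neq0 lambda t u C eps gap) => //.
  - by lra.
  - by lra.
  - by move=> x; exact: pos.
  - by move=> x s sS; exact: step.
  have -> : lambda * u = a + b * C * Num.sqrt (t1 + 1).
    by rewrite /u mulrC divfK ?gt_eqF.
  have : Num.sqrt (2 * (C ^+ 2 * t) / eps) <= b * C * Num.sqrt (t1 + 1).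
    have -> : 2 * (C ^+ 2 * t) / eps = 2 / eps * C ^+ 2 * t by ring.
    have e2 : 0 <= 2 / eps by rewrite divr_ge0// ltW.
    rewrite sqrtrM ?(mulr_ge0 e2 (sqr_ge0 _))// [X in X * _ <= _]sqrtrM//.
    rewrite sqrtr_sqr ger0_norm// ler_wpM2l ?(mulr_ge0 b0 C0)//.
    by rewrite ler_wsqrtr// ltW.
  rewrite /a; lra.
have t2u : t2 <= t1 + 1 + u.
  apply: (@le_trans _ _ (t + u)); last by rewrite lerD2r ltW.
  apply: inf_lbound => //; by case: (has_inf_mixing_times e0).
apply: le_trans t2u _.
pose s := Num.sqrt t1.
have s2 : s ^+ 2 = t1 by rewrite sqr_sqrtr//; lra.
have s0 : 0 <= s by exact: sqrtr_ge0.
have Cs : C <= q * s.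
  by apply: le_trans CqL _; rewrite ler_wpM2l ?(ltW q0)// ler_wsqrtr.
have sq : Num.sqrt (t1 + 1) <= 2 * s.
  rewrite -(@ler_pXn2r _ 2) ?nnegrE ?sqrtr_ge0 ?mulr_ge0//.
  by rewrite sqr_sqrtr ?exprMn ?s2; lra.
(* From C >= 1; this absorbs the constant parts of the window into multiples of t1 q. *)
have qt : 1 <= t1 * q.
  rewrite -s2; have : 1 <= q * s by lra.
  have : 1 <= s by have := sqrtr_ge0 t1; nra.
  nra.
have ub : u <= t1 * q * (a / lambda + 2 * b / lambda).
  have -> : t1 * q * (a / lambda + 2 * b / lambda) = (a * (t1 * q) + b * (2 * (t1 * q))) / lambda by ring.
  apply: ler_wpM2r; first by rewrite invr_ge0 ltW.
  apply: lerD; first by rewrite ler_peMr.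
  rewrite -mulrA ler_wpM2l// (_ : 2 * (t1 * q) = q * s * (2 * s)); last by rewrite -s2; ring.
  by rewrite ler_pM ?sqrtr_ge0//; lra.
have -> : t1 * (1 + window_const eps * q) =
   t1 + (t1 * q + t1 * q * (a / lambda + 2 * b / lambda)).
  by rewrite /window_const -/a -/b; ring.
lra.
Qed.

End mixing_window.

Lemma ln3_bounds (R : realType) : 1 <= ln (3 : R).
Proof.
rewrite -[leLHS]expRK ler_ln ?posrE ?expR_gt0//.
by have := @expR_le1D2x R 1; rewrite ler01 lexx => /(_ isT); lra.
Qed.

Lemma ln2_gt0 (R : realType) : 0 < ln (2 : R).
Proof. by rewrite ln_gt0// ltr1n. Qed.

(* At most [(m + 1) ^ k] vertices lie within [k] jumps, which is less than
   [2 ^ d] for [k < d ln 2 / ln (m + 1)]. *)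
Definition jump_scale (R : realType) (eps : R) (d m : nat) : R :=
  eps / 2 * (d%:R * ln 2 / ln m.+1%:R).

Lemma unif_tv_jump_scale (R : realType) d (S : {set Z3pow d}) (eps t : R) :
  (0 < #|S|)%N -> 0 < eps -> (2 / 3) ^+ d <= eps / 2 -> 0 <= t ->
  unif_tv S t <= 1 - eps -> jump_scale eps d #|S| <= t.
Proof.
move=> S0 e0 hd t0 htv.
have y0 : 0 < ln (#|S|.+1%:R : R) by rewrite ln_gt0// ltr1n ltnS.
set x : R := d%:R * ln 2 / ln #|S|.+1%:R.
have x0 : 0 <= x by rewrite divr_ge0 ?mulr_ge0// ltW// ln2_gt0.
(* With k <= x the ball has at most 2^d points, and x < k + 1 turns eps / 2 <= t / (k + 1) into the
   claim. *)
have /andP[kx xk] := truncn_itv x0; set k := Num.truncn x in kx xk.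
have low := unif_tv_lower S0 (eps := eps) k t0 htv.
have ball : #|S|.+1%:R ^+ k / #|Z3pow d|%:R <= eps / 2 :> R.
  apply: le_trans hd; rewrite card_Z3pow natrX expr_div_n ler_wpM2r ?invr_ge0 ?exprn_ge0//.
  have p2 : 0 < (2 : R) ^+ d by exact: exprn_gt0.
  have pS : 0 < (#|S|.+1%:R : R) ^+ k by exact: exprn_gt0.
  rewrite -ler_ln ?posrE// !lnXn//; move: kx; rewrite /x ler_pdivlMr//.
  by rewrite !mulr_natl.
have : eps / 2 <= t / k.+1%:R.
  by move: low ball; set a := t / _; set b := _ / #|_|%:R; lra.
rewrite ler_pdivlMr// => h2; apply: le_trans h2.
by rewrite /jump_scale -/x ler_wpM2l ?divr_ge0// ltW.
Qed.

(** With y = ln (m + 1), it suffices that y^3 is at most a small multiple of d. The bound exp y >=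
    y^4 / 4! gives y^4 = O(d), and y >= K makes the spare factor y beat the constants. *)
Lemma jump_scale_large (R : realType) (c eps q : R) : 2 < c -> 0 < eps -> 0 < q ->
  exists D : nat, forall d m : nat, (D <= d)%N -> c * d%:R <= m%:R <= c * d%:R + 1 ->
    2 + 2 * ln m%:R <= q * Num.sqrt (jump_scale eps d m).
Proof.
move=> c2 e0 q0; have l2 := ln2_gt0 R.
pose K : R := 32 * 24 * (c + 2) / (eps * ln 2 * q ^+ 2).
exists (maxn 2 (Num.truncn (expR K)).+1) => d m.
rewrite geq_max => /andP[d2 dK] /andP[hm1 hm2].
have dR2 : (2 : R) <= d%:R by rewrite ler_nat.
have Kd : expR K <= d%:R.
  by apply: ltW; apply: lt_le_trans (truncnS_gt _) _; rewrite ler_nat.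
have m4 : (4 : R) <= m%:R by nra.
set y : R := ln m.+1%:R.
have m10 : 0 < (m.+1%:R : R) by [].
have yK : K <= y.
  rewrite -[leLHS]expRK ler_ln ?posrE ?expR_gt0//; apply: le_trans Kd _.
  rewrite -natr1; nra.
have y1 : 1 <= y.
  apply: le_trans (ln3_bounds R) _; rewrite ler_ln ?posrE// -natr1; lra.
have lnm : ln m%:R <= y by rewrite ler_ln ?posrE// ?ler_nat//; lra.
have y4 : y ^+ 4 <= 24 * (c + 2) * d%:R.
  have := @expR_ge1Dxn R y 3; rewrite lnK ?posrE// -natr1.
  have -> : (4`!%:R : R) = 24 by [].
  move=> /(_ (le_trans ler01 y1)) h.
  have {}h : y ^+ 4 / 24 <= (c + 2) * d%:R by nra.
  by rewrite -mulrA -ler_pdivrMl// mulrC.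
have y0 : 0 < y by lra.
have d0 : 0 < (d%:R : R) by lra.
have Kpos : 0 < eps * ln 2 * q ^+ 2 by rewrite !mulr_gt0// exprn_gt0.
have J0 : 0 <= jump_scale eps d m.
  by rewrite /jump_scale -/y !mulr_ge0// ?invr_ge0// ltW.
apply: (@le_trans _ _ (4 * y)); first by lra.
rewrite -(@ler_pXn2r _ 2) ?nnegrE ?mulr_ge0 ?sqrtr_ge0 ?(ltW y0) ?(ltW q0)//.
rewrite !exprMn sqr_sqrtr// /jump_scale -/y.
have -> : q ^+ 2 * (eps / 2 * (d%:R * ln 2 / y)) = (eps * ln 2 * q ^+ 2) * d%:R / (2 * y).
  by field; rewrite gt_eqF.
rewrite ler_pdivlMr ?mulr_gt0//.
have hK : 32 * (24 * (c + 2)) <= eps * ln 2 * q ^+ 2 * y.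
  by move: yK; rewrite /K ler_pdivrMr//; lra.
rewrite -(ler_pM2r y0).
apply: (@le_trans _ _ (32 * y ^+ 4)); first by rewrite le_eqVlt; apply/orP; left; apply/eqP; ring.
apply: (@le_trans _ _ (32 * (24 * (c + 2) * d%:R))); first by rewrite ler_wpM2l.
have -> : 32 * (24 * (c + 2) * d%:R) = 32 * (24 * (c + 2)) * d%:R by ring.
have -> : eps * ln 2 * q ^+ 2 * d%:R * y = eps * ln 2 * q ^+ 2 * y * d%:R by ring.
by rewrite ler_wpM2r// ltW.
Qed.

Lemma cvg_EFin_dist (R : realType) (X : nat -> \bar R) (l : R) :
  (forall eta : R, 0 < eta -> exists D : nat, forall d : nat, (D <= d)%N ->
     exists2 x : R, X d = x%:E & `|l - x| <= eta) ->
  (X @ \oo --> l%:E)%classic.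
Proof.
move=> h; apply: cvg_EFin.
  by have [D hD] := h 1 ltr01; exists D => // d /= /hD[x -> _].
apply/cvgrPdist_le => eta eta0; have [D hD] := h eta eta0.
by exists D => // d /= /hD[x xE hx]; rewrite xE.
Qed.

Section spread_sequence.
Variables (R : realType) (c rho : R) (d1 : nat) (T : forall d, {set Z3pow d}).
Hypotheses (c2 : 2 < c) (rho1 : rho < 1).
Hypothesis T_card : forall d, (d1 <= d)%N ->
  c * d%:R <= #|T d|%:R <= c * d%:R + 1.
Hypothesis T_spec : forall d, (d1 <= d)%N -> spectral_bound (T d) rho.
Let P d := @cayley_kernel R (Z3pow d) (T d).
Arguments P : clear implicits.

Let lambda0 : 0 < 1 - rho. Proof. by rewrite subr_gt0. Qed.

(** The free parameter q serves both limits: it controls the relative window and also the ratio of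
    ln m to sqrt t1. *)
Lemma sequence_estimate (eps q : R) : 0 < eps < 1 / 2 -> 0 < q <= 1 ->
  exists D : nat, forall d : nat, (D <= d)%N -> exists t1 t2 : R,
   [/\ tmix (P d) (1 - eps) = t1%:E, tmix (P d) eps = t2%:E, 0 < t1 & t1 <= t2] /\
   [/\ t2 <= t1 * (1 + window_const (1 - rho) eps * q),
       2 + 2 * ln #|T d|%:R <= q * Num.sqrt t1 &
       exists2 r : R, trel (P d) = r%:E & 0 <= r <= (1 - rho)^-1].
Proof.
move=> heps hq; have /andP[e0 e12] := heps; have /andP[q0 q1] := hq.
have [D1 hD1] := jump_scale_large c2 e0 q0.
have [D2 hD2] : exists D2, forall d, (D2 <= d)%N -> (2 / 3) ^+ d <= eps / 2 :> R.
  have z1 : `|2 / 3 : R| < 1 by rewrite ger0_norm//; lra.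
  have /cvgrPdist_le/(_ (eps / 2)) := cvg_expr z1.
  move=> /(_ (divr_gt0 e0 (ltr0Sn R 1)))[D2 _ hD2]; exists D2 => d /hD2 /=.
  by rewrite sub0r normrN ger0_norm// exprn_ge0//; lra.
exists (maxn (maxn D1 D2) (maxn d1 1)) => d; rewrite !geq_max.
move=> /andP[/andP[dD1 dD2] /andP[dd1 d0]].
have hm := T_card dd1; have /andP[hm1 hm2] := hm.
have d1R : (1 : R) <= d%:R by rewrite ler1n.
have cd2 : 2 <= c * d%:R.
  by apply: le_trans (ltW c2) _; rewrite ler_peMr// (le_trans _ (ltW c2)).
have m1 : (1 < #|T d|)%N.
  by rewrite -(ltr_nat R); move: hm1; set a : R := #|T d|%:R; lra.
have m0 : (0 < #|T d|)%N by exact: ltnW.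
have gap := spectral_bound_poincare m0 (T_spec dd1).
have hC := hD1 d #|T d| dD1 hm.
have G1 : (1 < #|Z3pow d|)%N by rewrite card_Z3pow -(expn0 3) ltn_exp2l.
have lnm0 : 0 <= ln (#|T d|%:R : R) by rewrite ln_ge0// ler1n.
have C1 : 1 <= 2 + 2 * ln (#|T d|%:R : R) by lra.
have pos (t : R) x : 1 <= t -> 0 < heat_kernel (P d) t x 0.
  move=> t1; have t0 : 0 < t by lra.
  have [_ _ irr] := cayley_irreducible m0 lambda0 gap G1.
  have [k hk] := irr x 0.
  apply: lt_le_trans (heat_kernel_ge (cayley_stochastic R m0) x 0 k (ltW t0)).
  by rewrite mulr_gt0 ?expR_gt0// mulr_gt0 ?exprn_gt0// divr_gt0// ltr0n fact_gt0.
have step (t : R) x s : 1 <= t -> s \in T d ->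
    `|ln (heat_kernel (P d) t (x + s) 0) - ln (heat_kernel (P d) t x 0)| <=
    2 + 2 * ln #|T d|%:R.
  move=> t1 sT; apply: ln_heat_kernel_step => //; first exact: Z3pow_mulrn3.
  by move=> y; exact: pos.
have low (t : R) : 0 <= t -> unif_tv (T d) t <= 1 - eps -> jump_scale eps d #|T d| <= t.
  by move=> t0; apply: unif_tv_jump_scale => //; exact: hD2.
have [t1 [t2 [E1 E2 Lt1 t12 t2le]]] :=
  window_estimate m0 lambda0 gap heps C1 hq hC pos step low.
have J0 : 0 < jump_scale eps d #|T d|.
  rewrite ltNge; apply/negP => /ler0_sqrtr h; move: hC; rewrite h mulr0; lra.
exists t1, t2; split; split => //; first exact: lt_le_trans Lt1.
  by apply: le_trans hC _; rewrite ler_wpM2l ?(ltW q0)// ler_wsqrtr.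
have := cayley_trel_le m0 lambda0 gap; have := cayley_trel_ge0 m0 lambda0 gap G1.
rewrite -/(P d); case: (trel (P d)) => [r||]//=.
by rewrite !lee_fin => r0 r1; exists r => //; rewrite r0 r1.
Qed.

Lemma window_const_gt0 (eps : R) : 0 < eps < 1 / 2 -> 0 < window_const (1 - rho) eps.
Proof.
move=> /andP[e0 e12]; rewrite /window_const.
have h1 : 0 <= ln (2 / eps) by rewrite ln_ge0// ler_pdivlMr//; lra.
have h2 : ln eps <= 0 by rewrite ln_le0//; lra.
have h3 : 0 <= (ln (2 / eps) / 2 - ln eps) / (1 - rho) by apply: divr_ge0; [lra|exact: ltW].
have h4 : 0 <= 2 * Num.sqrt (2 / eps) / (1 - rho).
  by apply: divr_ge0; [rewrite mulr_ge0// sqrtr_ge0|exact: ltW].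
lra.
Qed.

Let ratio (t1 t2 : R) : t1 != 0 -> (t2%:E / t1%:E)%E = (t2 / t1)%:E.
Proof. by move=> t0; rewrite inver (negbTE t0). Qed.

(** The window bounds the quotient for eps < 1/2; for eps > 1/2 the quotient is the reciprocal of
    the one at 1 - eps. *)
Lemma spread_cutoff : cutoff P.
Proof.
move=> eps /andP[e0 e1].
have main (e : R) : 0 < e < 1 / 2 -> forall eta : R, 0 < eta ->
    exists D : nat, forall d : nat, (D <= d)%N -> exists t1 t2 : R,
    [/\ tmix (P d) (1 - e) = t1%:E, tmix (P d) e = t2%:E, 0 < t1 & t1 <= t2] /\
    t2 <= t1 * (1 + eta).
  move=> he eta eta0; have w0 := window_const_gt0 he.
  pose q := Num.min 1 (eta / window_const (1 - rho) e).
  have hq : 0 < q <= 1.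
    by rewrite lt_min ltr01 divr_gt0//= ge_min lexx.
  have [D hD] := sequence_estimate he hq; exists D => d /hD[t1 [t2 [h [t2le _ _]]]].
  exists t1, t2; split => //; apply: le_trans t2le _; case: h => _ _ t10 _.
  rewrite ler_pM2l// lerD2l mulrC -ler_pdivlMr//.
  by rewrite ge_min lexx orbT.
apply: cvg_EFin_dist => eta eta0.
have [elt|egt|->] := ltgtP eps (1 / 2).
- have he : 0 < eps < 1 / 2 by rewrite e0.
  have [D hD] := main eps he eta eta0; exists D => d /hD[t1 [t2 [[-> -> t10 t12] t2le]]].
  exists (t2 / t1); first by rewrite ratio// gt_eqF.
  rewrite distrC ger0_norm; last by rewrite subr_ge0 ler_pdivlMr// mul1r.
  by rewrite lerBlDl ler_pdivrMr// mulrC.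
- have he : 0 < 1 - eps < 1 / 2 by apply/andP; split; lra.
  have [D hD] := main _ he eta eta0; exists D => d /hD[t1 [t2 [[]]]].
  rewrite subKr => -> -> t10 t12 t2le; have t20 : 0 < t2 by exact: lt_le_trans t12.
  exists (t1 / t2); first by rewrite ratio// gt_eqF.
  rewrite ger0_norm; last by rewrite subr_ge0 ler_pdivrMr// mul1r.
  rewrite lerBlDr -lerBlDl ler_pdivlMr//; nra.
(* At eps = 1/2 the quotient is t / t; the levels 1/4 and 3/4 enclose t and show that it is finite
   and positive. *)
have he : 0 < (1 / 4 : R) < 1 / 2 by apply/andP; split; lra.
have [D hD] := main _ he eta eta0; exists D => d /hD[t1 [t2 [[E1 E2 t10 t12] _]]].
have mono (a b : R) : a <= b -> (tmix (P d) b <= tmix (P d) a)%E.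
  move=> ab; apply: ereal_inf_le_tmp => _ [t [t0 ht] <-]; exists t => //.
  by split => //; exact: le_trans ht ab.
have -> : 1 - 1 / 2 = 1 / 2 :> R by field.
have h1 : (t1%:E <= tmix (P d) (1 / 2))%E by rewrite -E1; apply: mono; lra.
have h2 : (tmix (P d) (1 / 2) <= t2%:E)%E by rewrite -E2; apply: mono; lra.
case: (tmix (P d) (1 / 2)) h1 h2 => [t||]//; rewrite !lee_fin => h1 h2.
have t0 : 0 < t by exact: lt_le_trans h1.
exists 1; last by rewrite subrr normr0 ltW.
by rewrite ratio ?gt_eqF// divff// gt_eqF.
Qed.

Lemma spread_product_condition (eps : R) : 0 < eps < 1 / 2 ->
  (forall d, (d1 <= d)%N -> kmax (P d) = 2%N) ->
  (forall d, (d1 <= d)%N -> Delta (P d) = #|T d|%:R) ->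
  ((fun d : nat => ((kmax (P d))%:R ^+ 2 * (1 + ln (Delta (P d))))%:E
     * trel (P d) / sqrte (tmix (P d) (1 - eps)))%E @ \oo --> 0%E)%classic.
Proof.
move=> heps hk hD; apply: cvg_EFin_dist => eta eta0.
(* For k = 2 the factor 4 (1 + ln m) is 2 (2 + 2 ln m), at most 2 q sqrt t1, and the relaxation time
   contributes at most 1 / (1 - rho). *)
pose q := Num.min 1 (eta * (1 - rho) / 2).
have hq : 0 < q <= 1.
  by rewrite lt_min ltr01 divr_gt0 ?mulr_gt0//= ge_min lexx.
have [D1 hD1] := sequence_estimate heps hq; exists (maxn D1 d1) => d.
rewrite geq_max => /andP[/hD1 [t1 [t2 [[-> _ t10 _] [_ hC [r -> /andP[r0 r1]]]]]] dd1].
rewrite hk// hD// /sqrte -EFinM.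
have s0 : 0 < Num.sqrt t1 by rewrite sqrtr_gt0.
rewrite ratio ?gt_eqF//; eexists; first reflexivity.
have hq2 : q <= eta * (1 - rho) / 2 by rewrite ge_min lexx orbT.
have dm : 0 <= 2 + 2 * ln (#|T d|%:R : R).
  rewrite addr_ge0// mulr_ge0//; have [m0|m0] := leqP #|T d| 0.
    by move: m0; rewrite leqn0 => /eqP ->; rewrite ln0.
  by rewrite ln_ge0// ler1n.
rewrite sub0r normrN ger0_norm; last first.
  apply: divr_ge0; last exact: ltW.
  by apply: mulr_ge0 => //; apply: mulr_ge0; [exact: sqr_ge0|lra].
rewrite ler_pdivrMr//.
apply: (@le_trans _ _ (2 * (q * Num.sqrt t1) * (1 - rho)^-1)).
  apply: ler_pM => //; last by lra.
  by apply: mulr_ge0; [exact: sqr_ge0|lra].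
rewrite ler_pdivrMr//.
have := ler_wpM2r (ltW s0) hq2; lra.
Qed.

End spread_sequence.

(** * Random generating sets *)
Lemma uniform_preimage (R : realType) (disp : measure_display)
    (Omega : measurableType disp) (Pr : probability Omega R) (E : finType)
    (X : Omega -> E) (A : {set E}) (Q : pred E) : uniform_on Pr X A ->
  measurable [set w | Q (X w)]%classic /\
  Pr [set w | Q (X w)]%classic = (#|[set a in A | Q a]%SET|%:R / #|A|%:R)%:E.
Proof.
move=> hX.
have QE : [set w | Q (X w)]%classic =
    (\bigcup_(a in [set` enum Q]) X @^-1` [set a])%classic.
  apply/seteqP; split=> [w /= Qw|w [a /= + ->]]; last by rewrite mem_enum.
  by exists (X w) => //=; rewrite mem_enum.
have mX a : measurable (X @^-1` [set a])%classic by case: (hX a).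
split; first by rewrite QE; apply: fin_bigcup_measurable.
rewrite QE measure_fin_bigcup//; last by move=> a b _ _ [w [/= <- <-]].
rewrite -fsbig_seq ?enum_uniq// big_enum/=.
rewrite (eq_bigr (fun a => ((a \in A)%:R / #|A|%:R)%:E)); last first.
  by move=> a _; case: (hX a).
rewrite sumEFin -mulr_suml; congr (_ / _)%:E.
rewrite -sum1_card natr_sum.
rewrite [RHS](eq_bigl (fun a => Q a && (a \in A))) => [|a]; last by rewrite inE andbC.
by rewrite big_mkcondr/=; apply: eq_bigr => a _; case: (a \in A).
Qed.

Lemma sum_expr_le (R : realType) (z : R) n : 0 <= z < 1 ->
  \sum_(0 <= k < n) z ^+ k <= (1 - z)^-1.
Proof.
move=> /andP[z0 z1]; have h : 0 < 1 - z by rewrite subr_gt0.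
rewrite -(ler_pM2l h) mulfV ?gt_eqF// big_mkord -opprB mulNr -subrX1 opprB.
by rewrite lerBlDr lerDl exprn_ge0.
Qed.

Lemma borel_cantelli_geometric (R : realType) (disp : measure_display)
    (Omega : measurableType disp) (Pr : probability Omega R)
    (F : nat -> set Omega) (K z : R) : 0 <= K -> 0 <= z < 1 ->
  (forall n, measurable (F n)) -> (forall n, Pr (F n) <= (K * z ^+ n)%:E)%E ->
  {ae Pr, forall w, exists n0, forall n, (n0 <= n)%N -> ~ F n w}.
Proof.
move=> K0 hz mF hF; exists (lim_sup_set F); split.
- by apply: bigcap_measurable => // k _; apply: bigcup_measurable.
- apply: lim_sup_set_cvg0 => //.
  apply: (@le_lt_trans _ _ (K / (1 - z))%:E); last by rewrite ltry.
  apply: lime_le; first by apply: is_cvg_nneseries => n _ _; exact: measure_ge0.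
  apply: nearW => n; apply: (@le_trans _ _ (\sum_(0 <= k < n) (K * z ^+ k)%:E)%E).
    by apply: lee_sum => k _; exact: hF.
  by rewrite sumEFin lee_fin -mulr_sumr ler_wpM2l// sum_expr_le.
move=> w /= hw n _; apply: contrapT => h; apply: hw; exists n => k nk Fk.
by apply: h; exists k.
Qed.

Section random_generators.
Variables (R : realType) (c rho gamma : R).
Hypotheses (hc : 2 * ln 3 < c) (hrho : Num.sqrt (2 * ln 3 / c) < rho < 1).
Hypothesis hgamma : gamma = c * rho ^+ 2 / 2 - ln 3.

Let ln3 : 1 <= ln (3 : R). Proof. exact: ln3_bounds. Qed.

Lemma c_gt2 : 2 < c. Proof. by move: hc ln3; lra. Qed.

Lemma rho_bounds : 0 <= rho <= 1.
Proof.
have /andP[h1 h2] := hrho; rewrite (ltW h2) andbT.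
by apply: le_trans (ltW h1); exact: sqrtr_ge0.
Qed.

Lemma gamma_gt0 : 0 < gamma.
Proof.
have c0 : 0 < c by have := c_gt2; lra.
have /andP[h1 _] := hrho.
have q0 : 0 <= 2 * ln 3 / c by apply: divr_ge0 (ltW c0); move: ln3; lra.
have : 2 * ln 3 / c < rho ^+ 2.
  by rewrite -[ltLHS]sqr_sqrtr//; have := sqrtr_ge0 (2 * ln 3 / c); nra.
by rewrite ltr_pdivrMr// hgamma; lra.
Qed.

Lemma gens_card_bounds d : c * d%:R <= (gens_card c d)%:R <= c * d%:R + 1.
Proof.
have cd0 : 0 <= c * d%:R by rewrite mulr_ge0//; have := c_gt2; lra.
have z0 : 0 <= Num.ceil (c * d%:R) by rewrite ceil_ge0; lra.
have -> : (gens_card c d)%:R = (Num.ceil (c * d%:R))%:~R :> R.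
  by rewrite /gens_card -[in RHS](gez0_abs z0).
have /andP[h1 h2] := real_ceil_itv (num_real (c * d%:R)).
by rewrite h2/=; move: h1; rewrite intrB; lra.
Qed.

Lemma gens_card_gt0 d : (0 < d)%N -> (0 < gens_card c d)%N.
Proof.
move=> d0; rewrite -(ltr_nat R); have /andP[h _] := gens_card_bounds d.
apply: lt_le_trans h; rewrite mulr_gt0 ?ltr0n//; have := c_gt2; lra.
Qed.

Definition failure_bound (d : nat) : R :=
  expR (- gamma * d%:R) + (gens_card c d)%:R * (3 : R) ^ (1 - d%:Z).

Lemma card_failure d : (0 < d)%N -> (gens_card c d < 3 ^ d)%N ->
  #|[set A in nonzero_subsets (Z3pow d) (gens_card c d) |
      ~~ well_spread (gens_card c d) rho A]%SET|%:R /
    #|nonzero_subsets (Z3pow d) (gens_card c d)|%:R <= failure_bound d.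
Proof.
move=> d0 md; set ns := nonzero_subsets _ _; have m0 := gens_card_gt0 d0.
have cns : #|ns| = 'C(#|Z3pow d|.-1, gens_card c d).
  by rewrite /ns nonzero_subsetsE card_draws_in card_nonzero.
have ns0 : (0 : R) < #|ns|%:R.
  by rewrite ltr0n cns bin_gt0 card_Z3pow -ltnS prednK// expn_gt0.
rewrite ler_pdivrMr// mulrC.
have hm : (0 < gens_card c d < 3 ^ d)%N by rewrite m0.
apply: le_trans (card_not_well_spread rho_bounds hm) _.
rewrite -cns ler_wpM2l ?(ltW ns0)// lerD2r.
have /andP[hm1 _] := gens_card_bounds d.
have -> : ((3 ^ d)%:R : R) = expR (ln 3 * d%:R).
  by rewrite mulrC expRM_natl lnK ?posrE// natrX.
rewrite -expRD ler_expR hgamma.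
have : c * d%:R * rho ^+ 2 <= (gens_card c d)%:R * rho ^+ 2.
  by rewrite ler_wpM2r// sqr_ge0.
lra.
Qed.

Lemma failure_bound_geometric : exists K z : R, [/\ 0 <= K, 0 <= z < 1 &
  forall d, (0 < d)%N -> failure_bound d <= K * z ^+ d].
Proof.
have g0 := gamma_gt0; have c2 := c_gt2.
pose z := Num.max (expR (- gamma)) (2 / 3).
have z1 : z < 1 by rewrite gt_max expR_lt1 oppr_lt0 g0/=; lra.
have z0 : 0 <= z by rewrite le_max expR_ge0.
exists (1 + 3 * (c + 1)), z; split=> [||d d0]; [lra|by rewrite z0 z1|].
have h1 : expR (- gamma * d%:R) <= z ^+ d.
  by rewrite mulrC expRM_natl lerXn2r ?nnegrE ?expR_ge0// le_max lexx.
have h2 : (2 / 3) ^+ d <= z ^+ d.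
  by rewrite lerXn2r ?nnegrE ?divr_ge0// le_max lexx orbT.
have e3 : (3 : R) ^ (1 - d%:Z) = 3 * (3 ^+ d)^-1.
  by rewrite expfzDr ?pnatr_eq0// expr1z exprnN.
(* Trading d for 2^d leaves the ratio 2 / 3 after division by 3^d. *)
have hm : (gens_card c d)%:R <= (c + 1) * 2 ^+ d.
  have /andP[_ hm] := gens_card_bounds d; apply: le_trans hm _.
  have dR : (1 : R) <= d%:R by rewrite ler1n.
  have d2 : (d%:R : R) <= 2 ^+ d by rewrite -natrX ler_nat ltnW// ltn_expl.
  nra.
have p3 : 0 <= ((3 : R) ^+ d)^-1 by rewrite invr_ge0 exprn_ge0.
have h3 : (gens_card c d)%:R * (3 * (3 ^+ d)^-1) <= 3 * (c + 1) * (2 / 3) ^+ d.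
  rewrite expr_div_n mulrCA -mulrA ler_wpM2l// !mulrA ler_wpM2r//.
have h4 : 3 * (c + 1) * (2 / 3) ^+ d <= 3 * (c + 1) * z ^+ d.
  by rewrite ler_wpM2l//; lra.
have -> : (1 + 3 * (c + 1)) * z ^+ d = z ^+ d + 3 * (c + 1) * z ^+ d by ring.
by rewrite /failure_bound e3; apply: lerD => //; exact: le_trans h4.
Qed.

Lemma well_spread_good d (A : {set Z3pow d}) : (0 < d)%N ->
  A \in nonzero_subsets (Z3pow d) (gens_card c d) ->
  well_spread (gens_card c d) rho A ->
  spectral_bound A rho /\ nonreversible_walk_bounds A (gens_card c d) rho.
Proof.
move=> d0; rewrite inE => /andP[A0 /eqP Am] /andP[/forallP spec /eqP AN].
have sp : spectral_bound A rho by move=> a a0; have := spec a; rewrite a0 Am.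
split => //; rewrite -Am; have /andP[_ r1] := hrho.
by apply: spectral_bound_good => //; rewrite Am gens_card_gt0.
Qed.

End random_generators.

Unset Implicit Arguments.

Theorem theorem3p7 (R : realType) (c rho gamma : R)
  (hc : 2 * ln 3 < c)
  (hrho : Num.sqrt (2 * ln 3 / c) < rho < 1)
  (hgamma : gamma = c * rho ^+ 2 / 2 - ln 3)
  (d0 : nat) (hd0 : (1 <= d0)%N)
  (hm : forall d : nat, (d0 <= d)%N -> (gens_card c d <= 3 ^ d - 1)%N)
  (disp : measure_display) (Omega : measurableType disp)
  (Pr : probability Omega R)
  (S : forall d : nat, Omega -> {set Z3pow d})
  (hS : forall d : nat, (d0 <= d)%N ->
     uniform_on Pr (S d) (nonzero_subsets (Z3pow d) (gens_card c d))) :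
  let P (w : Omega) (d : nat) := @cayley_kernel R (Z3pow d) (S d w) in
  let good (w : Omega) (d : nat) :=
    nonreversible_walk_bounds (S d w) (gens_card c d) rho in
  (forall d : nat, (d0 <= d)%N ->
     measurable [set w | good w d]%classic /\
     ((1 - expR (- gamma * d%:R)
         - (gens_card c d)%:R * (3 : R) ^ (1 - d%:Z))%:E
       <= Pr [set w | good w d]%classic)%E) /\
  {ae Pr, forall w, exists2 d1 : nat, (d0 <= d1)%N &
     [/\ forall d : nat, (d1 <= d)%N -> good w d,
         forall eps : R, 0 < eps < 1 / 2 ->
           ((fun d : nat =>
               ((kmax (P w d))%:R ^+ 2 * (1 + ln (Delta (P w d))))%:E
               * trel (P w d) / sqrte (tmix (P w d) (1 - eps)))%E @ \oo
            --> 0%E)%classic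
       & cutoff (P w)]}.
Proof.
move=> P good.
have d_gt0 d : (d0 <= d)%N -> (0 < d)%N by exact: leq_trans.
have m_lt d : (d0 <= d)%N -> (gens_card c d < 3 ^ d)%N.
  move=> /hm; rewrite -ltnS subn1 prednK// expn_gt0//.
(* Values outside [nonzero_subsets] have probability zero but may occur at some w, so they count as
   failures. *)
pose fails d (A : {set Z3pow d}) := ~~ ((A \in nonzero_subsets (Z3pow d) (gens_card c d))
  && well_spread (gens_card c d) rho A).
have Pfails d : (d0 <= d)%N -> measurable [set w | fails d (S d w)]%classic /\
    (Pr [set w | fails d (S d w)]%classic <= (failure_bound c gamma d)%:E)%E.
  move=> dd; have [mf ->] := uniform_preimage (fails d) (hS d dd); split => //.
  rewrite lee_fin.
  apply: le_trans (card_failure hc hrho hgamma (d_gt0 d dd) (m_lt d dd)).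
  rewrite ler_wpM2r ?invr_ge0// ler_nat; apply: subset_leq_card.
  apply/fintype.subsetP => A; rewrite !inE /fails !inE => /andP[-> h] /=.
  by move: h; rewrite andTb.
have good_of d w : (d0 <= d)%N -> ~~ fails d (S d w) ->
    spectral_bound (S d w) rho /\ good w d.
  move=> dd; rewrite negbK => /andP[h1 h2].
  exact: (well_spread_good hc hrho (d_gt0 d dd) h1 h2).
split=> [d dd|].
  (* The event depends on w only through a set in a finite type, so its boolean reflection is a
     measurable preimage. *)
  have [mg _] := uniform_preimage (fun A => `[<nonreversible_walk_bounds A (gens_card c d) rho>]) (hS d dd).
  have gE : [set w | good w d]%classic =
      [set w | `[<nonreversible_walk_bounds (S d w) (gens_card c d) rho>]]%classic.
    by apply/seteqP; split=> w /= /asboolP.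
  split; first by rewrite gE.
  have [mf hf] := Pfails d dd.
  apply: (@le_trans _ _ (Pr (~` [set w | fails d (S d w)])%classic)).
    rewrite probability_setC// -addrA -opprD EFinB; apply: leeB => //.
  apply: le_measure; rewrite ?inE//; first exact: measurableC.
    by rewrite gE.
  by move=> w /= /negP h; have [] := good_of d w dd h.
have [K [z [K0 hz hKz]]] := failure_bound_geometric hc hrho hgamma.
(* Below [d0] nothing is known about [S d], not even measurability. *)
pose F d := if (d0 <= d)%N then [set w | fails d (S d w)]%classic else set0.
have mF n : measurable (F n).
  by rewrite /F; case: ifP => // /Pfails[].
have PF n : (Pr (F n) <= (K * z ^+ n)%:E)%E.
  rewrite /F; case: ifP => [nd|_].
    have [_ h] := Pfails n nd; apply: le_trans h _.
    by rewrite lee_fin hKz// d_gt0.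
  by rewrite measure0 lee_fin mulr_ge0// exprn_ge0//; case/andP: hz.
apply: filterS (borel_cantelli_geometric K0 hz mF PF) => w [n0 hn0].
exists (maxn d0 n0); first exact: leq_maxl.
have ok d : (maxn d0 n0 <= d)%N -> ~~ fails d (S d w).
  rewrite geq_max => /andP[dd /hn0 h]; apply/negP => f; apply: h.
  by rewrite /F dd.
have ge_d0 d : (maxn d0 n0 <= d)%N -> (d0 <= d)%N by rewrite geq_max => /andP[].
have card_S d : (maxn d0 n0 <= d)%N -> #|S d w| = gens_card c d.
  by move=> /ok; rewrite negbK => /andP[]; rewrite inE => /andP[_ /eqP].
have spec d : (maxn d0 n0 <= d)%N -> spectral_bound (S d w) rho.
  by move=> hd; have [] := good_of d w (ge_d0 d hd) (ok d hd).
have goodw d : (maxn d0 n0 <= d)%N -> good w d.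
  by move=> hd; have [] := good_of d w (ge_d0 d hd) (ok d hd).
have Sc d : (maxn d0 n0 <= d)%N -> c * d%:R <= #|S d w|%:R <= c * d%:R + 1.
  by move=> /card_S ->; exact: gens_card_bounds hc d.
have rho1 : rho < 1 by case/andP: hrho.
split => //.
  move=> eps heps.
  apply: (spread_product_condition (T := S ^~ w) (c_gt2 hc) rho1 Sc spec heps).
    by move=> d /goodw[_ _ _ []].
  by move=> d hd; rewrite card_S//; have [_ _ _ []] := goodw d hd.
exact: (spread_cutoff (T := S ^~ w) (c_gt2 hc) rho1 Sc spec).
Qed.
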